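(* Let $\Sigma$ be distributed according to the uniform biased sparse PCA (UBSPCA) model with parameters $n,p,k$ and $\beta>0$, with $p/n\to c>0$. Then, for some $\xi$ that satisfies $$\xi=\frac1k+O\left(\sqrt{\frac{(1+\beta)k}{k_{info}}}\right),$$ with probability tending to $1$ as $(n,p,k)\to\infty$ the following holds: for every two sets $\mathcal{I},\mathcal{J}\subseteq\{1,\ldots,p\}$ of size $k$, if $|\mathcal{I}\cap\mathcal{I}^*|-|\mathcal{J}\cap\mathcal{I}^*|>\xi k$, then $\lambda_1(\Sigma_{\mathcal{I}})>\lambda_1(\Sigma_{\mathcal{J}})$.
   Context: UBSPCA model: $\mathbf{v}^*\in\mathbb{R}^p$ is a unit vector with exactly $k$ non-zero entries, all equal to $1/\sqrt{k}$, and $\mathcal{I}^*\subseteq\{1,\ldots,p\}$ is its support, $|\mathcal{I}^*|=k$. The signal strength is $\beta$. The samples $\mathbf{x}_1,\ldots,\mathbf{x}_n\in\mathbb{R}^p$ are i.i.d. from $\mathcal{N}(0,\beta\mathbf{v}^*{\mathbf{v}^*}^T+I_p)$, $X$ is the $n\times p$ matrix whose rows are the samples, and $\Sigma=\frac1n X^TX$. Probability is over the choice of $X$. For $\mathcal{S}\subseteq\{1,\ldots,p\}$, $\Sigma_{\mathcal{S}}$ is the principal submatrix of $\Sigma$ indexed by $\mathcal{S}$, and $\lambda_1(\cdot)$ denotes the largest eigenvalue. The quantity $k_{info}$ satisfies $k_{info}\asymp\beta^2n/\log p$, where $f\asymp g$ means that $f/g\to c'$ for some constant $c'>0$. *)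

(* Defs.v *)
From HB Require Import structures.
From mathcomp Require Import all_boot all_order all_algebra.
From mathcomp Require Import all_classical all_reals all_analysis.

Set Implicit Arguments.
Unset Strict Implicit.
Unset Printing Implicit Defensive.

Import Order.TTheory GRing.Theory Num.Theory.
Import numFieldNormedType.Exports.

Local Open Scope classical_set_scope.
Local Open Scope ring_scope.

(* [normal_prob] takes a standard deviation, and is not the intended law when
   that is 0, whence the Dirac mass. *)
Definition gaussian_law (R : realType) (mu var : R) (A : set R) : \bar R :=
  if var == 0 then \d_mu A else normal_prob mu (Num.sqrt var) A.

(* A random vector is N(mu, C) when every linear form a^T x is (possibly
   degenerate) normal with mean a^T mu and variance a^T C a. *)
Definition gaussian_vector (R : realType) (d : measure_display)
    (T : measurableType d) (P : probability T R) (p : nat)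
    (mu : 'cV[R]_p) (C : 'M[R]_p) (x : {RV P >-> p.-tuple R}) : Prop :=
  forall (a : 'cV[R]_p) (A : set R), measurable A ->
    P [set w | A (\sum_(j < p) a j 0 * tnth (x w) j)] =
    gaussian_law ((a^T *m mu) 0 0) ((a^T *m C *m a) 0 0) A.

Definition mutually_independent (R : realType) (d d' : measure_display)
    (T : measurableType d) (T' : measurableType d') (P : probability T R)
    (I : finType) (x : I -> {RV P >-> T'}) : Prop :=
  forall (J : {set I}) (A : I -> set T'), (forall i, measurable (A i)) ->
    P [set w | forall i, i \in J -> A i (x i w)] =
    (\prod_(i in J) P (x i @^-1` A i))%E.

Definition vsupport (R : realType) (p : nat) (v : 'cV[R]_p) : {set 'I_p} :=
  [set j | v j 0 != 0]%SET.

Definition ubspca_signal (R : realType) (p k : nat) (v : 'cV[R]_p) : Prop :=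
  [/\ \sum_(j < p) v j 0 ^+ 2 = 1,
      #|vsupport v| = k &
      forall j, j \in vsupport v -> v j 0 = (Num.sqrt k%:R)^-1].

Definition ubspca_samples (R : realType) (d : measure_display)
    (T : measurableType d) (P : probability T R) (n p : nat)
    (beta : R) (v : 'cV[R]_p) (x : 'I_n -> {RV P >-> p.-tuple R}) : Prop :=
  mutually_independent x /\
  forall i, gaussian_vector 0 (beta *: (v *m v^T) + 1%:M) (x i).

Definition data_matrix (R : realType) (d : measure_display)
    (T : measurableType d) (P : probability T R) (n p : nat)
    (x : 'I_n -> {RV P >-> p.-tuple R}) (w : T) : 'M[R]_(n, p) :=
  \matrix_(i < n, j < p) tnth (x i w) j.

Definition sample_covariance (R : realType) (n p : nat) (X : 'M[R]_(n, p)) :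
    'M[R]_p :=
  n%:R^-1 *: (X^T *m X).

Definition principal_submx (R : realType) (p : nat) (S : {set 'I_p})
    (A : 'M[R]_p) : 'M[R]_#|S| :=
  \matrix_(i < #|S|, j < #|S|) A (enum_val i) (enum_val j).

(* For a symmetric matrix of positive size the set of real eigenvalues is
   finite and nonempty, so this [sup] is its maximum. *)
Definition lambda1 (R : realType) (q : nat) (A : 'M[R]_q) : R :=
  sup [set a : R | eigenvalue A a].

Definition asymp (R : realType) (f g : nat -> R) : Prop :=
  exists2 c : R, 0 < c & f m / g m @[m --> \oo] --> c.

(* Main.v *)
(** Write [C = 1 + beta v v^T] for the covariance and whiten the data by
    [C^(-1/2)]; let [E] be the deviation of the whitened sample covariance from
    the identity. A chi-square Chernoff bound and a grid net show that, with
    probability tending to 1, the form [E] is at most [O(s + s^2)] on all unit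
    vectors with at most [2k] non-zero entries, where [s^2 = k ln p / n]. For a
    unit vector [a] and [theta = <v, a>],
      [a^T Sigma a = 1 + (beta + g^2 E(v, v)) theta^2 + 2 g theta E(a, v) + E(a, a)]
    with [g = sqrt (1 + beta) - 1], and the largest [theta^2] for [a] supported
    on [S] is [|S :&: Istar| / k]. The two error terms are [O(sqrt (1 + beta) s)]
    as soon as [s <= sqrt (1 + beta)], and for larger [s] one has [xi >= 1], so
    that the assertion is void. *)
Require Import Defs.
From HB Require Import structures.
From mathcomp Require Import all_boot all_order all_algebra.
From mathcomp Require Import all_classical all_reals all_analysis.
From mathcomp Require Import measurable_realfun.
From mathcomp Require Import ring lra zify.

Set Implicit Arguments.
Unset Strict Implicit.
Unset Printing Implicit Defensive.

Import Order.TTheory GRing.Theory Num.Theory.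
Import numFieldNormedType.Exports.

Local Open Scope classical_set_scope.
Local Open Scope ring_scope.

(** * Densities, independence and Gaussian squares *)

(** The obstacle is a strong spike. The unwhitened deviation of [Sigma] in the direction [v] scales
    with [1 + beta], and an error of that size would cost a full factor [1 + beta] where [xi] allows
    only its square root. After whitening, the one term of this size is [g^2 E(v, v) theta^2]. Like
    the signal it multiplies [theta^2], so it changes the strength of the spike equally for all test
    vectors and need not be small: it only has to leave half of [beta], for which [|E(v, v)| <= 1/2]
    is enough. That event concerns a single vector and needs no union bound. Nothing makes [s] small
    or [beta] bounded. Hence the tail exponent [u * min u 1], which covers both the Gaussian and the
    exponential range, and a separate treatment of [E(a, v)] for large [s]. Finally, [lambda1] is a
    supremum of eigenvalues. It is identified with the maximum of the Rayleigh quotient, both for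
    the estimates and for the measurability of the event, which is reduced to countably many test
    vectors. *)

Section density.
Context d1 d2 (X : measurableType d1) (Y : measurableType d2) (R : realType).
Variables (phi : X -> Y) (mphi : measurable_fun setT phi).
Variables (mu : {measure set X -> \bar R}) (nu : {measure set Y -> \bar R}).
Variables (h : X -> R) (mh : measurable_fun setT h) (h0 : forall x, 0 <= h x).
Hypothesis nuE : forall A, measurable A ->
  nu A = (\int[mu]_x (h x * \1_A (phi x))%:E)%E.

Import HBNNSimple.

(* With [phi] the identity this integrates against a density; with [h] the
   product of the other factors it separates one factor of an independent
   family. *)
Lemma ge0_integral_density (f : Y -> R) : measurable_fun setT f ->
  (forall y, 0 <= f y) ->
  (\int[nu]_y (f y)%:E = \int[mu]_x (h x * f (phi x))%:E)%E.
Proof.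
move=> mf f0.
have mfE : measurable_fun [set: Y] (EFin \o f) by exact/measurable_EFinP.
pose f_ := nnsfun_approx measurableT mfE.
have cvf y : (f_ n y)%:E @[n --> \oo] --> (f y)%:E.
  by apply: cvg_nnsfun_approx => // z _; rewrite lee_fin.
have ndf y : {homo f_ ^~ y : m n / (m <= n)%N >-> m <= n}.
  by move=> m n mn; exact/lefP/nd_nnsfun_approx.
have mhphi (g : Y -> R) : measurable_fun setT g ->
    measurable_fun setT (fun x => (h x * g (phi x))%:E).
  by move=> mg; apply/measurable_EFinP/measurable_funM => //; exact: measurableT_comp.
transitivity (limn (fun n => \int[nu]_y (f_ n y)%:E))%E.
  rewrite -monotone_convergence//.
  - by apply: eq_integral => y _; apply/esym/cvg_lim.
  - by move=> n; exact/measurable_EFinP/measurable_funP.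
  - by move=> n y _; rewrite lee_fin.
  - by move=> y _ m n mn; rewrite lee_fin; exact: ndf.
rewrite [X in limn X](_ : _ =
    (fun n => \int[mu]_x (h x * f_ n (phi x))%:E))%E.
  rewrite -monotone_convergence//; last 3 first.
  - by move=> n; apply: mhphi.
  - by move=> n x _; rewrite lee_fin mulr_ge0.
  - by move=> x _ m n mn; rewrite lee_fin ler_wpM2l//; exact: ndf.
  apply: eq_integral => x _; apply/cvg_lim => //.
  rewrite (_ : (fun _ => _) = fun n => ((h x)%:E * (f_ n (phi x))%:E)%E)//.
  by rewrite EFinM; apply: cvgeZl => //; exact: (cvf (phi x)).
apply/funext => n.
transitivity (\sum_(k \in range (f_ n))
    \int[nu]_y (k * \1_(f_ n @^-1` [set k]) y)%:E)%E.
  under eq_integral do rewrite fimfunE -fsumEFin//.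
  rewrite ge0_integral_fsum//.
  - by move=> y; exact/measurable_EFinP/measurable_funM.
  - by move=> y x _; rewrite nnfun_muleindic_ge0.
transitivity (\sum_(k \in range (f_ n))
    \int[mu]_x (h x * (k * \1_(f_ n @^-1` [set k]) (phi x)))%:E)%E; last first.
  rewrite -ge0_integral_fsum//.
  - apply: eq_integral => x _; rewrite EFinM fimfunE -fsumEFin// ge0_mule_fsumr//.
    by move=> r; have := nnfun_muleindic_ge0 (f_ n) r (phi x); rewrite EFinM.
  - by move=> y; apply: (mhphi (fun z => y * \1_(f_ n @^-1` [set y]) z)); exact: measurable_funM.
  - move=> y x _; rewrite EFinM mule_ge0// ?lee_fin//.
    by have := nnfun_muleindic_ge0 (f_ n) y (phi x); rewrite lee_fin.
apply: eq_fsbigr => r _; rewrite integralZl_indic_nnsfun// integral_indic//= setIT.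
rewrite nuE//; have [r0|r0] := leP 0 r; last first.
  rewrite preimage_nnfun0//; under eq_integral do rewrite indic0 mulr0.
  under [RHS]eq_integral do rewrite indic0 !mulr0.
  by rewrite !integral0 mule0.
rewrite -ge0_integralZl_EFin//.
- by apply: eq_integral => x _; rewrite -EFinM mulrCA.
- by move=> x _; rewrite lee_fin mulr_ge0.
- exact: mhphi.
Qed.
End density.

Section independence.
Context d d' (T : measurableType d) (T' : measurableType d') (R : realType).
Variables (P : probability T R) (I : finType) (x : I -> {RV P >-> T'}).
Hypothesis indep : mutually_independent x.

(** Independence is stated for events; this carries it over to expectations, as the Chernoff bound
    requires. Nonnegative factors spare integrability conditions, and finite values [e i] keep the
    product in [R]. *)
Lemma ge0_integral_indep_prod (f : I -> T' -> R) (e : I -> R) :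
  (forall i, measurable_fun setT (f i)) -> (forall i y, 0 <= f i y) ->
  (forall i, \int[P]_w (f i (x i w))%:E = (e i)%:E)%E ->
  (\int[P]_w (\prod_i f i (x i w))%:E = (\prod_i e i)%:E)%E.
Proof.
move=> mf f0 fE.
have e0 i : 0 <= e i.
  by rewrite -lee_fin -fE; apply: integral_ge0 => w _; rewrite lee_fin.
(* The factors [f i] replace indicators one index at a time: for fixed other
   factors, both sides are measures of the set in the remaining slot. *)
pose h (s : seq I) (A : I -> set T') i y : R := if i \in s then f i y else \1_(A i) y.
pose c (s : seq I) (A : I -> set T') i : R := if i \in s then e i else fine (P (x i @^-1` A i)).
have mx i (A : set T') : measurable A -> measurable (x i @^-1` A).
  by move=> mA; rewrite -[X in measurable X]setTI; exact: measurable_funP.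
have mh s A i : (forall i, measurable (A i)) -> measurable_fun setT (h s A i).
  move=> mA; rewrite /h; case: (i \in s) => //; exact: measurable_indic.
have h0 s A i y : 0 <= h s A i y by rewrite /h; case: ifP.
have c0 s A i : 0 <= c s A i by rewrite /c; case: ifP => // _; exact: fine_ge0.
suff main s : uniq s -> forall A, (forall i, measurable (A i)) ->
    (\int[P]_w (\prod_i h s A i (x i w))%:E = (\prod_i c s A i)%:E)%E.
  rewrite (eq_bigr (c (enum I) (fun=> setT))) => [|i _]; last by rewrite /c mem_enum.
  rewrite -main ?enum_uniq//; apply: eq_integral => w _; congr EFin.
  by apply: eq_bigr => i _; rewrite /h mem_enum.
elim: s => [_ A mA|i0 s IH /= /andP[i0s us] A mA].
  have -> : (fun w => (\prod_i h [::] A i (x i w))%:E) =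
      EFin \o \1_[set w | forall i, i \in [set: I]%SET -> A i (x i w)].
    apply/funext => w; rewrite /= indicE; congr EFin.
    have [wS|wS] := boolP (w \in _).
      by apply: big1 => i _; rewrite /h /= indicE mem_set//; apply: (set_mem wS); rewrite inE.
    have /existsNP[i Ai] : ~ forall i, A i (x i w).
      by move=> Aw; move: wS => /negP; apply; apply/mem_set => i _; exact: Aw.
    by rewrite (bigD1 i)//= /h/= indicE memNset// mul0r.
  rewrite integral_indic//; last first.
    rewrite (_ : mkset _ = \bigcap_(i in setT) (x i @^-1` A i)).
      by apply: fin_bigcap_measurable => // i _; exact: mx.
    by apply/seteqP; split=> w /= Aw i _; apply: Aw; rewrite ?inE.
  rewrite setIT; apply: (etrans (indep [set: I]%SET mA)).
  rewrite -prodEFin; apply: eq_big => [i|i _]; first by rewrite !inE.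
  by rewrite /c/= fineK// fin_num_measure//; exact: mx.
pose H w := \prod_(i | i != i0) h (i0 :: s) A i (x i w).
pose C := \prod_(i | i != i0) c (i0 :: s) A i.
have mH : measurable_fun setT H.
  have -> : H = fun w => \prod_(i <- index_enum I)
      (if i != i0 then h (i0 :: s) A i (x i w) else 1).
    by apply/funext => w; rewrite /H big_mkcond.
  apply: measurable_prod => i _; case: (i != i0) => //.
  by apply: measurableT_comp => //; exact: mh.
have H0 w : 0 <= H w by exact: prodr_ge0.
have C0 : 0 <= C by exact: prodr_ge0.
pose A' B i := if i == i0 then B else A i.
have hA' B i y : i != i0 -> h (i0 :: s) A i y = h s (A' B) i y.
  by move=> ii0; rewrite /h /A' inE (negbTE ii0).
have cA' B i : i != i0 -> c (i0 :: s) A i = c s (A' B) i.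
  by move=> ii0; rewrite /c /A' inE (negbTE ii0).
have key B : measurable B -> (\int[P]_w (H w * \1_B (x i0 w))%:E =
     C%:E * P (x i0 @^-1` B))%E.
  move=> mB; have mA' i : measurable (A' B i) by rewrite /A'; case: ifP.
  have := IH us _ mA'.
  rewrite (bigD1 i0)//= {1}/c (negbTE i0s) /A' eqxx.
  rewrite EFinM fineK ?fin_num_measure//; last exact: mx.
  rewrite muleC (eq_bigr (c (i0 :: s) A)) => [<-|i ii0]; last by rewrite (cA' B).
  apply: eq_integral => w _; congr EFin; rewrite (bigD1 i0)//= mulrC.
  have -> : h s (A' B) i0 (x i0 w) = \1_B (x i0 w) by rewrite /h (negbTE i0s) /A' eqxx.
  by congr (_ * _); apply: eq_bigr => i ii0; exact: hA'.
pose nu := mscale (NngNum C0) (distribution P (x i0)).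
rewrite [in RHS](bigD1 i0)//=.
under eq_integral do rewrite (bigD1 i0)//= mulrC {2}/h inE eqxx/=.
under eq_integral do rewrite -/(H _).
rewrite -(@ge0_integral_density _ _ _ _ _ _ _ _ nu)//; last by move=> B mB; rewrite key.
have mfi : measurable_fun [set: T'] (EFin \o f i0) by exact/measurable_EFinP.
rewrite ge0_integral_mscale//; last by move=> y _; rewrite lee_fin.
rewrite (ge0_integral_distribution _ mfi); last by move=> y; rewrite lee_fin.
by rewrite /= fE /c inE eqxx /= -EFinM mulrC.
Qed.
End independence.

Section gaussian_square.
Context d (T : measurableType d) (R : realType).
Variables (P : probability T R).

(** The left side is the exponential moment of a centred Gaussian square, with [z = lam * s2]. Its
    logarithm is [z^2 + 4/3 z^3 + ...], whence a bound [2 z^2] near 0. *)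
Lemma gaussian_square_factor_le (z : R) : `|z| <= 8^-1 ->
  (Num.sqrt (1 - 2 * z))^-1 * expR (- z) <= expR (2 * z ^+ 2).
Proof.
rewrite ler_norml => /andP[z1 z2].
have q0 : 0 < Num.sqrt (1 - 2 * z) by rewrite sqrtr_gt0; lra.
rewrite mulrC ler_pdivrMr//.
(* With [expR y >= 1 + y] at [y = z + 2 z^2], the claim becomes the polynomial inequality
   [(1 - 2 z) (1 + z + 2 z^2)^2 >= 1]. *)
have -> : - z = 2 * z ^+ 2 + - (z + 2 * z ^+ 2) by ring.
rewrite expRD ler_pM2l ?expR_gt0//.
have y1 : 0 < 1 + (z + 2 * z ^+ 2) by nra.
rewrite expRN (@le_trans _ _ (1 + (z + 2 * z ^+ 2))^-1)//.
  by rewrite lef_pV2 ?posrE ?expR_gt0// expR_ge1Dx.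
rewrite -(ler_pXn2r (ltn0Sn 1)) ?nnegrE ?invr_ge0 ?(ltW y1) ?(ltW q0)// sqr_sqrtr; last lra.
rewrite exprVn -[leLHS]mul1r ler_pdivrMr ?exprn_gt0//.
rewrite -subr_ge0.
have -> : (1 - 2 * z) * (1 + (z + 2 * z ^+ 2)) ^+ 2 - 1 =
   z ^+ 2 * (1 - 6 * z - 4 * z ^+ 2 - 8 * z ^+ 3) by ring.
rewrite mulr_ge0 ?sqr_ge0//.
have z3 : z ^+ 2 <= 64^-1 by nra.
have : z ^+ 3 <= 8^-1 * 64^-1 by rewrite exprS; nra.
lra.
Qed.

Lemma integral_exp_gaussian_square (Y : T -> R) (s2 lam : R) :
  measurable_fun setT Y -> 0 <= s2 ->
  (forall A, measurable A -> P [set w | A (Y w)] = gaussian_law 0 s2 A) ->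
  `|lam * s2| <= 8^-1 ->
  exists2 e : R, (\int[P]_w (expR (lam * (Y w ^+ 2 - s2)))%:E = e%:E)%E &
    e <= expR (2 * (lam * s2) ^+ 2).
Proof.
move=> mY s20 law lams.
pose f (y : R) := expR (lam * (y ^+ 2 - s2)).
have mf' : measurable_fun setT f.
  apply: measurableT_comp => //; apply: measurable_funM => //.
  by apply: measurable_funB => //; exact: measurable_funX.
(* [normal_prob] is a measure on [measurableTypeR R], whose display is not
   that of [R]. *)
have mf : measurable_fun [set: measurableTypeR R] f by exact: mf'.
have f0 y : 0 <= f y by exact: expR_ge0.
have lawE (nu : {measure set (measurableTypeR R) -> \bar R}) : (forall A, measurable A -> P [set w | A (Y w)] = nu A) ->
    (\int[P]_w (f (Y w))%:E = \int[nu]_y (f y)%:E)%E.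
  move=> nuE; rewrite (@ge0_integral_density _ _ _ (measurableTypeR R) _ _ mY P nu (cst 1))//.
    by apply: eq_integral => w _; rewrite mul1r.
  move=> A mA; rewrite -nuE//; under eq_integral do rewrite mul1r.
  rewrite (_ : (fun w => _) = EFin \o \1_(Y @^-1` A)).
    by rewrite integral_indic//= ?setIT// -[X in measurable X]setTI; exact: mY.
  by apply/funext => w.
(* Variance 0 does occur: the zero vector is one of the grid vectors to which the tail bound is
   applied. *)
have [s20'|s2n0] := eqVneq s2 0.
  exists 1; last by rewrite s20' mulr0 expr0n mulr0 expR0.
  rewrite (lawE (\d_(0 : measurableTypeR R))); last by move=> A mA; rewrite law// /gaussian_law s20' eqxx.
  rewrite integral_dirac//; last exact/measurable_EFinP.
  by rewrite diracT mul1e /f s20' expr0n subrr mulr0 expR0.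
have s2p : 0 < s2 by rewrite lt_neqAle eq_sym s2n0.
rewrite (lawE (normal_prob 0 (Num.sqrt s2))); last first.
  by move=> A mA; rewrite law// /gaussian_law (negbTE s2n0).
set s := Num.sqrt s2; set z := lam * s2.
have s_gt0 : 0 < s by rewrite sqrtr_gt0.
have sn0 : s != 0 by rewrite gt_eqF.
have sE : s ^+ 2 = s2 by rewrite sqr_sqrtr.
have q0' : 0 < 1 - 2 * z by move: lams; rewrite ler_norml => /andP[]; rewrite -/z; lra.
pose q := Num.sqrt (1 - 2 * z).
have q0 : 0 < q by rewrite sqrtr_gt0.
have qn0 : q != 0 by rewrite gt_eqF.
have qE : q ^+ 2 = 1 - 2 * z by rewrite sqr_sqrtr// ltW.
exists (q^-1 * expR (- z)); last exact: gaussian_square_factor_le.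
rewrite (@ge0_integral_density _ _ (measurableTypeR R) (measurableTypeR R) _ id _ lebesgue_measure _ (normal_pdf 0 s))//; first last.
- move=> A mA; rewrite /normal_prob [LHS]integral_mkcond.
  apply: eq_integral => x _; rewrite patchE indicE.
  by case: (x \in A); rewrite ?mulr1 ?mulr0.
- by move=> x; exact: normal_pdf_ge0.
- exact: measurable_normal_pdf.
pose K := q^-1 * expR (- z).
(* Completing the exponent turns the integrand into a multiple of the normal
   density with standard deviation [s / q]. *)
transitivity (\int[lebesgue_measure]_x (K%:E * (normal_pdf 0 (s / q) x)%:E))%E.
  apply: eq_integral => x _; rewrite -EFinM; congr EFin.
  rewrite !normal_pdfE//; last by rewrite mulf_neq0// invr_neq0.
  rewrite /normal_peak /normal_fun /f.
  have -> : Num.sqrt ((s / q) ^+ 2 * pi *+ 2) = Num.sqrt (s ^+ 2 * pi *+ 2) / q.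
    rewrite expr_div_n -[q^-1]ger0_norm ?invr_ge0 ?ltW// -sqrtr_sqr -sqrtrM.
      by congr Num.sqrt; rewrite exprVn; ring.
    by rewrite mulrn_wge0// mulr_ge0 ?sqr_ge0// pi_ge0.
  set N := Num.sqrt _; rewrite -mulrA -expRD /K invfM invrK.
  rewrite [RHS](_ : _ = N^-1 * (expR (- z) * expR (- (x - 0) ^+ 2 / ((s / q) ^+ 2 *+ 2)))); last first.
    by set Ni := N^-1; field.
  congr (_ * _); rewrite -expRD; congr expR.
  rewrite subr0 expr_div_n qE sE /z; field.
  by rewrite s2n0 andbT -/z gt_eqF.
rewrite ge0_integralZl_EFin//.
- by rewrite integral_normal_pdf mule1.
- by move=> x _; rewrite lee_fin normal_pdf_ge0.
- apply/measurable_EFinP; exact: (measurable_normal_pdf 0 (s / q)).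
- by rewrite /K mulr_ge0 ?expR_ge0// invr_ge0 ltW.
Qed.
End gaussian_square.

Section chernoff_bound.
Context d d' (T : measurableType d) (T' : measurableType d') (R : realType).
Variables (P : probability T R) (n : nat) (x : 'I_n -> {RV P >-> T'}).
Hypothesis indep : mutually_independent x.
Variables (l : T' -> R) (s2 : R).
Hypothesis ml : measurable_fun setT l.
Hypothesis s2_ge0 : 0 <= s2.
Hypothesis s2_le2 : s2 <= 2.
Hypothesis law : forall i A, measurable A ->
  P [set w | A (l (x i w))] = gaussian_law 0 s2 A.

Let mlx i : measurable_fun setT (fun w => l (x i w)).
Proof. by apply: measurableT_comp. Qed.

Lemma measurable_sum_sqr_rv : measurable_fun setT (fun w => \sum_(i < n) l (x i w) ^+ 2).
Proof. by apply: measurable_sum => i; apply: measurable_funX. Qed.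

(** Markov's inequality for the exponential with parameter [m / 16] up to sign, where [m = min u 1].
    As [s2 <= 2], this keeps [|lam * s2| <= 1/8]; the moment costs [8 (m / 16)^2 = m^2 / 32] per
    sample, at most half of the gain [m u / 16] because [m <= u]. The sign [b] selects the tail. *)
Lemma chernoff_sum_sqr_gaussian (b : bool) (u : R) : 0 < u ->
  (P [set w | (n%:R * u <= (-1) ^+ b * \sum_(i < n) (l (x i w) ^+ 2 - s2))%R]
    <= (expR (- (n%:R * (u * Num.min u 1)) / 32))%:E)%E.
Proof.
move=> u0; set m := Num.min u 1; set S := (X in P X).
have m0 : 0 < m by rewrite lt_min u0 ltr01.
have m1 : m <= 1 by rewrite ge_min lexx orbT.
have mu : m <= u by rewrite ge_min lexx.
clearbody m.
pose lam := (-1) ^+ b * (m / 16).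
have lamabs : `|lam| = m / 16 by rewrite normrMsign ger0_norm// divr_ge0// ltW.
have lams : `|lam * s2| <= 8^-1.
  rewrite normrM lamabs (ger0_norm s2_ge0).
  by have := ler_pM (ltW m0) s2_ge0 m1 s2_le2; lra.
have /choice[e eP] : forall i, exists e : R,
    (\int[P]_w (expR (lam * (l (x i w) ^+ 2 - s2)))%:E = e%:E)%E /\
    0 <= e <= expR (8 * (m / 16) ^+ 2).
  move=> i; have [e eE ele] := integral_exp_gaussian_square (mlx i) s2_ge0 (@law i) lams.
  exists e; split => //; apply/andP; split.
    by rewrite -lee_fin -eE; apply: integral_ge0 => w _; rewrite lee_fin expR_ge0.
  rewrite (le_trans ele)// ler_expR exprMn -[lam ^+ 2]real_normK ?num_real// lamabs.
  have s4 : s2 ^+ 2 <= 4 by rewrite expr2; move: s2_ge0 s2_le2; nra.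
  by have := sqr_ge0 (m / 16); nra.
have mY i : measurable_fun setT (fun w => l (x i w) ^+ 2 - s2).
  by apply: measurable_funB => //; exact: measurable_funX.
have mS : measurable S.
  rewrite -[S]setTI; apply: measurable_fun_le => //.
  by apply: measurable_funM => //; exact: measurable_sum.
have -> : P S = (\int[P]_w (\1_S w)%:E)%E by rewrite integral_indic// setIT.
pose f (i : 'I_n) (y : T') := expR (lam * (l y ^+ 2 - s2)).
have mf i : measurable_fun setT (f i).
  apply: measurableT_comp => //; apply: measurable_funM => //.
  by apply: measurable_funB => //; exact: measurable_funX.
have mfx : measurable_fun setT (fun w => \prod_(i < n) f i (x i w)).
  by apply: measurable_prod => i _; exact: (measurableT_comp (mf i)).
have fE : (\int[P]_w (\prod_(i < n) f i (x i w))%:E = (\prod_(i < n) e i)%:E)%E.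
  apply: (ge0_integral_indep_prod indep) => //.
    by move=> *; exact: expR_ge0.
  by move=> i; case: (eP i).
apply: (@le_trans _ _ (\int[P]_w ((expR (- (m / 16 * (n%:R * u))))%:E * (\prod_(i < n) f i (x i w))%:E)))%E.
  apply: ge0_le_integral => //.
  - by apply/measurable_EFinP.
  - by apply/measurable_EFinP; apply: measurable_funM.
  move=> w _; rewrite indicE; case: (boolP (w \in S)) => [|_]; last first.
    by rewrite -EFinM lee_fin mulr_ge0 ?expR_ge0// prodr_ge0// => i _; exact: expR_ge0.
  rewrite inE /S/= => Sw; rewrite -EFinM lee_fin /f -expR_sum -expRD.
  rewrite -[leLHS]expR0 ler_expR -mulr_sumr /lam.
  rewrite [leRHS](_ : _ = m / 16 * ((-1) ^+ b * \sum_(i < n) (l (x i w) ^+ 2 - s2) - n%:R * u)).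
    by rewrite mulr_ge0 ?subr_ge0// divr_ge0// ltW.
  ring.
rewrite ge0_integralZl_EFin ?expR_ge0//; last 2 first.
- by move=> w _; rewrite lee_fin prodr_ge0// => i _; exact: expR_ge0.
- exact/measurable_EFinP.
rewrite fE -EFinM lee_fin.
apply: (@le_trans _ _ (expR (- (m / 16 * (n%:R * u))) * expR (8 * (m / 16) ^+ 2) ^+ n)).
  rewrite ler_wpM2l ?expR_ge0// -[in leRHS](card_ord n) -prodr_const.
  by apply: ler_prod => i _; case: (eP i).
rewrite -expRM_natl -expRD ler_expR.
have : 0 <= n%:R * m * (u - m) by rewrite !mulr_ge0 ?subr_ge0// ltW.
lra.
Qed.

Lemma sum_sqr_gaussian_tail (u : R) : (0 < n)%N -> 0 < u ->
  (P [set w | (u <= `|n%:R^-1 * (\sum_(i < n) l (x i w) ^+ 2) - s2|)%R]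
    <= (2 * expR (- (n%:R * (u * Num.min u 1)) / 32))%:E)%E.
Proof.
move=> n0 u0.
pose S b := [set w | (n%:R * u <= (-1) ^+ b * \sum_(i < n) (l (x i w) ^+ 2 - s2))%R].
have mS b : measurable (S b).
  rewrite -[S b]setTI; apply: measurable_fun_le => //.
  apply: measurable_funM => //; apply: measurable_sum => i.
  by apply: measurable_funB => //; exact: measurable_funX.
rewrite (_ : [set w | _] = S false `|` S true).
  rewrite mulr2n mulrDl mul1r EFinD (le_trans (measureU2 _ _ _))//.
  by rewrite leeD// chernoff_sum_sqr_gaussian.
have E w : n%:R^-1 * (\sum_(i < n) l (x i w) ^+ 2) - s2 =
    n%:R^-1 * \sum_(i < n) (l (x i w) ^+ 2 - s2).
  rewrite sumrB sumr_const card_ord -[s2 *+ n]mulr_natl mulrBr mulKf// pnatr_eq0.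
  by rewrite -lt0n.
have n0' : 0 < n%:R :> R by rewrite ltr0n.
apply/seteqP; split => w /=; rewrite E ler_normr -mulrN !ler_pdivlMl// /S/= expr0 expr1 mul1r mulN1r.
  by case/orP; [left|right].
by case=> ->; rewrite ?orbT.
Qed.
End chernoff_bound.

(** * Bilinear forms and the largest eigenvalue *)

Section bilinear_forms.
Context (R : realType) (q : nat).
Implicit Types (M N : 'M[R]_q) (a b c : 'cV[R]_q) (t : R).

Definition bil M a b : R := (a^T *m M *m b) 0 0.
Definition dot a b : R := (a^T *m b) 0 0.

Lemma dotE a b : dot a b = \sum_j a j 0 * b j 0.
Proof. by rewrite /dot mxE; apply: eq_bigr => j _; rewrite mxE. Qed.

Lemma bil1 a b : bil 1%:M a b = dot a b.
Proof. by rewrite /bil mulmx1. Qed.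

Lemma bilE M a b : bil M a b = \sum_i \sum_j a i 0 * M i j * b j 0.
Proof.
rewrite /bil -mulmxA mxE; apply: eq_bigr => i _; rewrite !mxE mulr_sumr.
by apply: eq_bigr => j _; rewrite mulrA.
Qed.

Lemma bilDl M a b c : bil M (a + b) c = bil M a c + bil M b c.
Proof. by rewrite /bil linearD !mulmxDl mxE. Qed.
Lemma bilDr M a b c : bil M a (b + c) = bil M a b + bil M a c.
Proof. by rewrite /bil mulmxDr mxE. Qed.
Lemma bilZl M t a b : bil M (t *: a) b = t * bil M a b.
Proof. by rewrite /bil linearZ/= -!scalemxAl mxE. Qed.
Lemma bilZr M t a b : bil M a (t *: b) = t * bil M a b.
Proof. by rewrite /bil -scalemxAr mxE. Qed.
Lemma bilNl M a b : bil M (- a) b = - bil M a b.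
Proof. by rewrite -scaleN1r bilZl mulN1r. Qed.
Lemma bilNr M a b : bil M a (- b) = - bil M a b.
Proof. by rewrite -scaleN1r bilZr mulN1r. Qed.
Lemma bilD M N a b : bil (M + N) a b = bil M a b + bil N a b.
Proof. by rewrite /bil mulmxDr mulmxDl mxE. Qed.
Lemma bilB M N a b : bil (M - N) a b = bil M a b - bil N a b.
Proof. by rewrite /bil mulmxBr mulmxBl !mxE. Qed.
Lemma bil_scalar t a b : bil t%:M a b = t * dot a b.
Proof. by rewrite /bil mul_mx_scalar -scalemxAl mxE. Qed.

Lemma bilC M a b : M^T = M -> bil M a b = bil M b a.
Proof.
move=> Ms; rewrite /bil -[LHS](mxE trmx_key (fun i j => (a^T *m M *m b) j i)).
by rewrite -/(trmx _) !trmx_mul trmxK Ms mulmxA.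
Qed.

Lemma dotC a b : dot a b = dot b a.
Proof. by rewrite -!bil1 bilC// trmx1. Qed.

Lemma dot_ge0 a : 0 <= dot a a.
Proof. by rewrite dotE sumr_ge0// => j _; rewrite -expr2 sqr_ge0. Qed.

Lemma dot_eq0 a : (dot a a == 0) = (a == 0).
Proof.
apply/idP/eqP => [|->]; last by rewrite /dot mulmx0 mxE.
rewrite dotE psumr_eq0 => [/allP h|j _]; last by rewrite -expr2 sqr_ge0.
apply/matrixP => i j; rewrite ord1 mxE; apply/eqP.
by have := h i (mem_index_enum _); rewrite mulf_eq0 orbb.
Qed.

Lemma dot_gt0 a : a != 0 -> 0 < dot a a.
Proof. by move=> a0; rewrite lt_neqAle dot_ge0 eq_sym dot_eq0 a0. Qed.

Lemma coord_le_dot a j : `|a j 0| <= Num.sqrt (dot a a).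
Proof.
rewrite -sqrtr_sqr ler_wsqrtr// dotE (bigD1 j)//= -expr2 lerDl sumr_ge0// => i _.
by rewrite -expr2 sqr_ge0.
Qed.

Lemma bil_le_coord M : exists2 K, 0 <= K & forall a b s t,
  (forall j, `|a j 0| <= s) -> (forall j, `|b j 0| <= t) ->
  `|bil M a b| <= K * (s * t).
Proof.
exists (\sum_i \sum_j `|M i j|) => [|a b s t hs ht].
  by apply: sumr_ge0 => i _; apply: sumr_ge0.
rewrite bilE mulr_suml (le_trans (ler_norm_sum _ _ _))// ler_sum// => i _.
rewrite mulr_suml (le_trans (ler_norm_sum _ _ _))// ler_sum// => j _.
rewrite !normrM mulrAC mulrC ler_wpM2l//.
by rewrite ler_pM.
Qed.

(** A crude constant that depends on [M]. It only serves to make suprema over unit vectors finite,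
    and its strict positivity allows division by it. *)
Lemma bil_le_dot M : exists2 K, 0 < K & forall a, `|bil M a a| <= K * dot a a.
Proof.
have [K K0 h] := bil_le_coord M; exists (K + 1) => [|a]; first by rewrite ltr_wpDl.
rewrite (le_trans (h _ _ _ _ (coord_le_dot a) (coord_le_dot a)))//.
rewrite -expr2 sqr_sqrtr ?dot_ge0// ler_wpM2r ?dot_ge0//.
by rewrite lerDl.
Qed.

Lemma bil_CauchySchwarz M a b : M^T = M -> (forall c, 0 <= bil M c c) ->
  bil M a b ^+ 2 <= bil M a a * bil M b b.
Proof.
move=> Ms M0; set r := bil M a b.
have rE : bil M b a = r by rewrite bilC.
have pa := M0 a; have pb := M0 b.
have key1 : 0 <= bil M b b * (bil M a a * bil M b b - r ^+ 2).
  have := M0 (bil M b b *: a - r *: b).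
  rewrite bilDl bilNl !bilDr !bilNr !bilZl !bilZr rE -/r.
  by congr (_ <= _); ring.
have key2 : 0 <= bil M a a * (bil M a a * bil M b b - r ^+ 2).
  have := M0 (bil M a a *: b - r *: a).
  rewrite bilDl bilNl !bilDr !bilNr !bilZl !bilZr rE -/r.
  by congr (_ <= _); ring.
(* The form is only semidefinite, so neither diagonal value can be assumed positive. If both vanish,
   nonnegativity at [a + b] and [a - b] forces [r = 0]. *)
rewrite -subr_ge0; have [b0|bn0] := eqVneq (bil M b b) 0; last first.
  by rewrite -(@pmulr_rge0 _ (bil M b b))// lt_neqAle eq_sym bn0.
have [a0|an0] := eqVneq (bil M a a) 0; last first.
  by rewrite -(@pmulr_rge0 _ (bil M a a))// lt_neqAle eq_sym an0.
have h1 := M0 (a + b); have h2 := M0 (a - b).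
move: h1 h2; rewrite !bilDl !bilDr !bilNl !bilNr rE a0 b0 -/r => h1 h2.
have -> : r = 0 by lra.
by rewrite mul0r expr0n subrr.
Qed.

End bilinear_forms.

Lemma bil_congr (R : realType) (q r : nat) (M : 'M[R]_q) (L : 'M[R]_(q, r)) a b :
  bil (L^T *m M *m L) a b = bil M (L *m a) (L *m b).
Proof. by rewrite /bil trmx_mul !mulmxA. Qed.

Section largest_eigenvalue.
Context (R : realType) (q : nat).
Variable A : 'M[R]_q.
Hypotheses (q_gt0 : (0 < q)%N) (As : A^T = A).

Let rayleigh : set R := [set r | exists2 a, dot a a = 1 & r = bil A a a].

Let has_sup_rayleigh : has_sup rayleigh.
Proof.
split.
  pose a : 'cV[R]_q := delta_mx (Ordinal q_gt0) 0.
  exists (bil A a a); exists a => //; rewrite /dot trmx_delta mul_delta_mx mxE.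
  by rewrite !eqxx.
have [K _ h] := bil_le_dot A; exists K => _ [a a1 ->].
by have := h a; rewrite a1 mulr1; apply: le_trans; exact: ler_norm.
Qed.

Let bil_le_sup a : bil A a a <= sup rayleigh * dot a a.
Proof.
have [->|a0] := eqVneq a 0; first by rewrite /bil /dot !mulmx0 mxE mulr0.
have d0 := dot_gt0 a0; pose s := Num.sqrt (dot a a).
have s0 : 0 < s by rewrite sqrtr_gt0.
have sE : dot a a = s ^+ 2 by rewrite sqr_sqrtr ?dot_ge0.
have : bil A (s^-1 *: a) (s^-1 *: a) <= sup rayleigh.
  apply: ub_le_sup; first by case: has_sup_rayleigh.
  exists (s^-1 *: a) => //; rewrite -bil1 bilZl bilZr bil1 sE; field.
  by rewrite gt_eqF.
rewrite bilZl bilZr mulrA -invfM -expr2 mulrC ler_pdivrMr ?exprn_gt0//.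
by rewrite -sE.
Qed.

(* If [m - A] were invertible, Cauchy-Schwarz for this nonnegative form would
   bound it away from 0 on unit vectors, and [m] would not be the supremum. *)
Let eigenvalue_sup_rayleigh : eigenvalue A (sup rayleigh).
Proof.
set m := sup rayleigh; pose B := m%:M - A.
have Bs : B^T = B by rewrite /B linearB/= tr_scalar_mx As.
have B0 c : 0 <= bil B c c by rewrite bilB bil_scalar subr_ge0 bil_le_sup.
have [Bu|] := boolP (B \in unitmx); last first.
  rewrite unitmxE unitfE negbK => /det0P[v v0 vB].
  apply/eigenvalueP; exists v => //; apply/esym/eqP.
  by rewrite -subr_eq0 -mul_mx_scalar -mulmxBr vB.
have [K K0 h] := bil_le_dot (invmx B).
have : m <= m - K^-1.
  apply: ge_sup; first by case: has_sup_rayleigh.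
  move=> _ [a a1 ->]; set y := invmx B *m a.
  have Bay : bil B a y = 1 by rewrite /bil /y -mulmxA mulKVmx.
  have Byy : bil B y y <= K.
    have := h a; rewrite a1 mulr1; apply: le_trans; apply: le_trans (ler_norm _).
    by rewrite /bil /y trmx_mul trmx_inv Bs -!mulmxA mulKVmx.
  have := bil_CauchySchwarz a y Bs B0; rewrite Bay expr1n bilB bil_scalar a1 mulr1 => h1.
  have mA : 0 <= m - bil A a a.
    by rewrite subr_ge0 -[m]mulr1 -a1 bil_le_sup.
  rewrite lerBrDr -lerBrDl -[K^-1]mul1r ler_pdivrMr//.
  by rewrite (le_trans h1)// ler_wpM2l.
by rewrite lerBrDr gerDl leNgt invr_gt0 K0.
Qed.

(** An eigenvector gives a Rayleigh quotient equal to its eigenvalue, and the supremum of the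
    quotients is itself an eigenvalue. So [lambda1] is that supremum, and upper bounds on it are
    bounds on the form. *)
Lemma lambda1_le (m : R) :
  lambda1 A <= m <-> forall a, bil A a a <= m * dot a a.
Proof.
have ub r : eigenvalue A r -> r <= sup rayleigh.
  move=> /eigenvalueP[v vA v0].
  have vv : 0 < dot v^T v^T by rewrite dot_gt0// trmx_eq0.
  rewrite -(ler_pM2r vv) (le_trans _ (bil_le_sup v^T))//.
  rewrite /bil /dot trmxK vA -scalemxAl. by rewrite [leRHS]mxE.
have -> : lambda1 A = sup rayleigh.
  apply/eqP; rewrite eq_le; apply/andP; split.
    by apply: ge_sup => [|r /ub//]; exists (sup rayleigh); exact: eigenvalue_sup_rayleigh.
  apply: ub_le_sup; last exact: eigenvalue_sup_rayleigh.
  by exists (sup rayleigh) => r /ub.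
split=> [h a|h].
  by rewrite (le_trans (bil_le_sup a))// ler_wpM2r ?dot_ge0.
apply: ge_sup; first by case: has_sup_rayleigh.
by move=> _ [a a1 ->]; have := h a; rewrite a1 mulr1.
Qed.

End largest_eigenvalue.

(** * Uniform bounds on sparse vectors *)

Definition supported (R : realType) (p : nat) (S : {set 'I_p}) (a : 'cV[R]_p) :=
  forall j, j \notin S -> a j 0 = 0.

Section grid_net.
Context (R : realType) (p q L : nat).
Hypothesis L_gt0 : (0 < L)%N.

(* Repeated indices add up, and the value [L] encodes a zero coordinate. *)
Definition grid_vector (f : {ffun 'I_q -> 'I_p * 'I_(L.*2.+1)}) : 'cV[R]_p :=
  \col_j \sum_(i < q | (f i).1 == j) ((f i).2%:R - L%:R) / L%:R.

Let grid_coord (t : R) : `|t| <= 1 ->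
  exists z : 'I_(L.*2.+1), `|t - (z%:R - L%:R) / L%:R| <= L%:R^-1.
Proof.
have L0 : 0 < L%:R :> R by rewrite ltr0n.
move=> /[dup] t1; rewrite ler_norml => /andP[tl tr].
have y0 : 0 <= L%:R * (t + 1) by rewrite mulr_ge0// ?ler0n//; lra.
(* The index [z] in [0..2L] stands for [(z - L) / L] in [[-1, 1]]; rounding down loses less than
   [1 / L]. *)
have /andP[z1 z2] := truncn_itv y0; set z := Num.truncn _ in z1 z2.
have zL : (z < L.*2.+1)%N.
  rewrite ltnS -(ler_nat R) (le_trans z1)// -muln2 natrM ler_pM2l//; lra.
exists (Ordinal zL) => /=.
have -> : t - (z%:R - L%:R) / L%:R = (L%:R * (t + 1) - z%:R) / L%:R.
  by field; rewrite gt_eqF.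
rewrite normrM [`|_^-1|]ger0_norm ?invr_ge0 ?ler0n//.
rewrite -[leRHS]mul1r ler_pM2r ?invr_gt0// ler_norml.
move: z2; rewrite -natr1; move: z1; set y := L%:R * _ => z1 z2.
by apply/andP; split; lra.
Qed.

Lemma grid_vector_approx (S : {set 'I_p}) (a : 'cV[R]_p) :
  (#|S| <= q)%N -> supported S a -> dot a a = 1 ->
  exists f, [/\ supported S (grid_vector f) &
    forall j, `|a j 0 - grid_vector f j 0| <= L%:R^-1].
Proof.
move=> Sq Sa a1.
have [j0 j0S] : exists j0, j0 \in S.
  apply/set0Pn; apply/eqP => S0; move: a1; rewrite dotE big1 => [/eqP|j _].
    by rewrite eq_sym oner_eq0.
  by rewrite Sa ?S0 ?inE// mul0r.
have /choice[z zP] : forall j, exists z : 'I_(L.*2.+1),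
    `|a j 0 - (z%:R - L%:R) / L%:R| <= L%:R^-1.
  by move=> j; apply: grid_coord; rewrite (le_trans (coord_le_dot a j))// a1 sqrtr1.
pose s := enum S.
have ss : size s = #|S| by rewrite cardE.
have LL : (L < L.*2.+1)%N by rewrite ltnS -addnn leq_addr.
(* The first [#|S|] slots list [S] without repetition. The remaining ones repeat [j0], which lies in
   [S], with the value [L], so they add 0 and leave the support inside [S]. *)
pose f := [ffun i : 'I_q => (nth j0 s i,
  if (i < #|S|)%N then z (nth j0 s i) else Ordinal LL)].
have fS i : (f i).1 \in S.
  rewrite ffunE/=; have [iS|iS] := ltnP i (size s).
    by rewrite -mem_enum mem_nth.
  by rewrite nth_default.
exists f; split => [j jS|j].
  rewrite mxE big1// => i /eqP fij; move: jS; rewrite -fij fS//.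
have [jS|jS] := boolP (j \in S); last first.
  rewrite Sa// mxE big1 ?subr0 ?normr0 ?invr_ge0 ?ler0n// => i /eqP fij.
  by move: jS; rewrite -fij fS.
have js : (index j s < #|S|)%N by rewrite -ss index_mem mem_enum.
have jq : (index j s < q)%N by exact: leq_trans js Sq.
have nj : nth j0 s (index j s) = j by rewrite nth_index// mem_enum.
rewrite mxE (bigD1 (Ordinal jq))/=; last by rewrite ffunE/= nj.
rewrite big1 ?addr0 => [|i /andP[]].
  by rewrite ffunE/= js nj.
rewrite ffunE/=; case: ltnP => iS; last first.
  by rewrite subrr mul0r.
move=> /eqP fij /eqP []; apply: val_inj => /=.
by rewrite -fij index_uniq// ?enum_uniq// ss.
Qed.

End grid_net.

Section sparse_form_bound.
Context (R : realType) (p : nat) (E : 'M[R]_p).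
Hypothesis Es : E^T = E.

Lemma bil_polar_le (S : {set 'I_p}) (K : R) (a b : 'cV[R]_p) : 0 <= K ->
  (forall c, supported S c -> `|bil E c c| <= K * dot c c) ->
  supported S a -> supported S b ->
  `|bil E a b| <= K / 2 * (dot a a + dot b b).
Proof.
move=> K0 h Sa Sb.
have h1 : `|bil E (a + b) (a + b)| <= K * dot (a + b) (a + b).
  by apply: h => j jS; rewrite mxE Sa// Sb// addr0.
have h2 : `|bil E (a - b) (a - b)| <= K * dot (a - b) (a - b).
  by apply: h => j jS; rewrite !mxE Sa// Sb// subr0.
move: h1 h2; rewrite -!bil1 !bilDl !bilDr !bilNl !bilNr !bil1 !(dotC b a).
rewrite (bilC b a)//.
by rewrite !ler_norml => /andP[? ?] /andP[? ?]; apply/andP; split; lra.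
Qed.

(** Absorption: let [k] be the supremum of [|E(a, a)|] over supported unit vectors, finite by
    [bil_le_dot]. Passing to a net point [e] costs [E(c - e, c + e)], which is at most [k / 2], so
    [k <= u + k / 2]. *)
Lemma bil_net_bound (S : {set 'I_p}) (u : R) : 0 <= u ->
  (forall a, supported S a -> dot a a = 1 -> exists c,
    [/\ supported S c, dot (a - c) (a - c) <= 64^-1 & `|bil E c c| <= u]) ->
  forall a, supported S a -> `|bil E a a| <= 2 * u * dot a a.
Proof.
move=> u0 net.
pose V : set R := [set r | exists a, [/\ supported S a, dot a a = 1 & r = `|bil E a a|]].
have scale a : supported S a -> a != 0 ->
    let b := (Num.sqrt (dot a a))^-1 *: a in
    [/\ supported S b, dot b b = 1 & `|bil E a a| = `|bil E b b| * dot a a].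
  move=> Sa a0; set s := Num.sqrt _; move=> b.
  have s0 : 0 < s by rewrite sqrtr_gt0 dot_gt0.
  have sE : dot a a = s ^+ 2 by rewrite sqr_sqrtr ?dot_ge0.
  split.
  - by move=> j jS; rewrite mxE Sa// mulr0.
  - by rewrite -bil1 bilZl bilZr bil1 sE; field; rewrite gt_eqF.
  - rewrite bilZl bilZr mulrA normrM (@ger0_norm _ (s^-1 * _)); last first.
      by rewrite mulr_ge0// invr_ge0 ltW.
    by rewrite sE; field; rewrite gt_eqF.
have [K KK Kb] := bil_le_dot E.
have Vub : has_ubound V.
  by exists K => _ [a [_ a1 ->]]; have := Kb a; rewrite a1 mulr1.
move=> a Sa; have [->|a0] := eqVneq a 0.
  by rewrite /bil /dot !mulmx0 mxE normr0 mulr0.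
have [Sb b1 ->] := scale _ Sa a0; set b := _ *: a in Sb b1 *.
rewrite ler_wpM2r ?dot_ge0//.
have V0 : V !=set0 by exists `|bil E b b|, b.
pose k := sup V.
have Vk c : supported S c -> `|bil E c c| <= k * dot c c.
  move=> Sc; have [->|c0] := eqVneq c 0.
    by rewrite /bil /dot !mulmx0 mxE normr0 mulr0.
  have [Sd d1 ->] := scale _ Sc c0; rewrite ler_wpM2r ?dot_ge0//.
  by apply: ub_le_sup => //; eexists; split; [exact: Sd| |].
have k0 : 0 <= k.
  by rewrite (le_trans (normr_ge0 (bil E b b)))// (le_trans (Vk _ Sb))// b1 mulr1.
suff : k <= u + 3^-1 * k * (3 / 2).
  by have := Vk _ Sb; rewrite b1 mulr1; lra.
apply: ge_sup => // _ [c [Sc c1 ->]].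
have [e [Se de eu]] := net c Sc c1.
set x := c - e; set y := c + e.
have Sx : supported S x by move=> j jS; rewrite !mxE Sc// Se// subr0.
have Sy : supported S y by move=> j jS; rewrite !mxE Sc// Se// addr0.
(* Polarization bounds the product by a sum of squares. As [x] has norm at most 1/8 and [y] about 2,
   the factors 4 and 1/4 balance the two squares. *)
have -> : bil E c c = bil E e e + bil E (4 *: x) (4^-1 *: y).
  by rewrite bilZl bilZr /x /y bilDl bilNl !bilDr (bilC e c)//; field.
have yE : y = 2 *: c - x by apply/matrixP => i j; rewrite !mxE; ring.
have {}de : dot x x <= 64^-1 by [].
clearbody x y.
rewrite (le_trans (ler_normD _ _))// lerD//.
rewrite (le_trans (bil_polar_le k0 Vk _ _))//.
- by move=> j jS; rewrite mxE Sx// mulr0.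
- by move=> j jS; rewrite mxE Sy// mulr0.
have yy : dot y y <= 2 * (4 * dot c c + dot x x).
  have : 0 <= dot (2 *: c + x) (2 *: c + x) by exact: dot_ge0.
  rewrite yE.
  rewrite -!bil1 !bilDl !bilDr !bilNl !bilNr !bilZl !bilZr !bil1 (dotC x c). lra.
rewrite -!bil1 !bilZl !bilZr !bil1.
have : k * dot x x <= k * 64^-1 by rewrite ler_wpM2l.
have : k * dot y y <= k * (2 * (4 * dot c c + dot x x)) by rewrite ler_wpM2l.
rewrite c1; lra.
Qed.

End sparse_form_bound.

(** * Whitening and the comparison of two supports *)

Section principal_submatrix.
Context (R : realType) (p : nat).
Variables (S : {set 'I_p}) (A : 'M[R]_p).

Let sel : 'M[R]_(p, #|S|) := \matrix_(j, i) (j == enum_val i)%:R.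

Let selT_sel : sel^T *m sel = 1%:M.
Proof.
apply/matrixP => i j; rewrite !mxE (bigD1 (enum_val i))//= !mxE eqxx mul1r.
rewrite big1 ?addr0 => [|l /negbTE li]; last by rewrite !mxE li mul0r.
by rewrite (inj_eq enum_val_inj).
Qed.

Let principal_submxE : principal_submx S A = sel^T *m A *m sel.
Proof.
apply/matrixP => i j; rewrite !mxE (bigD1 (enum_val j))//= [sel _ _]mxE eqxx mulr1.
rewrite [X in _ = _ + X]big1 ?addr0 => [|l /negbTE li]; last by rewrite [sel _ _]mxE li mulr0.
rewrite mxE (bigD1 (enum_val i))//= !mxE eqxx mul1r big1 ?addr0// => l /negbTE li.
by rewrite !mxE li mul0r.
Qed.

Let sel_supported b : supported S (sel *m b).
Proof.
move=> j jS; rewrite mxE big1// => i _; rewrite mxE.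
case: eqP => [ji|_]; last by rewrite mul0r.
by move: jS; rewrite ji enum_valP.
Qed.

Let selK a : supported S a -> sel *m (sel^T *m a) = a.
Proof.
move=> Sa; apply/matrixP => j o; rewrite ord1 mxE.
have [jS|jS] := boolP (j \in S); last first.
  by rewrite Sa//; have := sel_supported (sel^T *m a) jS; rewrite mxE.
have [i0 ei0] : exists i0 : 'I_#|S|, enum_val i0 = j.
  by exists (enum_rank_in jS j); rewrite enum_rankK_in.
rewrite (bigD1 i0)//= big1 ?addr0 => [|i ii0]; last first.
  rewrite mxE -ei0; case: eqP => [/enum_val_inj ii|_]; last by rewrite mul0r.
  by rewrite ii eqxx in ii0.
rewrite mxE ei0 eqxx mul1r mxE (bigD1 j)//= big1 ?addr0.
  by rewrite !mxE ei0 eqxx mul1r.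
by move=> l lj; rewrite !mxE ei0 (negbTE lj) mul0r.
Qed.

(** [sel] includes the coordinates of [S] isometrically into the full space. All supports can then
    be compared inside the same space, with no change of dimension. *)
Lemma lambda1_principal_le (m : R) : A^T = A -> (0 < #|S|)%N ->
  lambda1 (principal_submx S A) <= m <->
  forall a, supported S a -> bil A a a <= m * dot a a.
Proof.
move=> As S0.
have Ps : (principal_submx S A)^T = principal_submx S A.
  by rewrite principal_submxE !trmx_mul trmxK As mulmxA.
have dotS b : dot b b = dot (sel *m b) (sel *m b).
  by rewrite -[RHS]bil1 -bil_congr mulmx1 selT_sel bil1.
rewrite lambda1_le//; split=> h a.
  move=> Sa; have := h (sel^T *m a).
  by rewrite principal_submxE bil_congr dotS !selK.
by rewrite principal_submxE bil_congr dotS; exact: h.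
Qed.

Lemma bil_le_unit (m : R) :
  (forall a, supported S a -> dot a a = 1 -> bil A a a <= m) ->
  forall a, supported S a -> bil A a a <= m * dot a a.
Proof.
move=> h a Sa; have [->|a0] := eqVneq a 0.
  by rewrite /bil /dot !mulmx0 mxE mulr0.
set s := Num.sqrt (dot a a).
have s0 : 0 < s by rewrite sqrtr_gt0 dot_gt0.
have sE : dot a a = s ^+ 2 by rewrite sqr_sqrtr ?dot_ge0.
have : bil A (s^-1 *: a) (s^-1 *: a) <= m.
  apply: h => [j jS|]; first by rewrite mxE Sa// mulr0.
  by rewrite -bil1 bilZl bilZr bil1 sE; field; rewrite gt_eqF.
by rewrite bilZl bilZr mulrA -invfM -expr2 mulrC ler_pdivrMr ?exprn_gt0// sE.
Qed.

End principal_submatrix.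

Section whitening.
Context (R : realType) (p : nat) (v : 'cV[R]_p) (g : R).
Hypotheses (v1 : dot v v = 1) (g0 : 0 <= g).

(* The square root of the covariance [1 + (2 g + g ^ 2) v v^T], and its inverse. *)
Definition spike_root : 'M[R]_p := 1%:M + g *: (v *m v^T).
Definition spike_whitening : 'M[R]_p := 1%:M - (g / (1 + g)) *: (v *m v^T).

Let vvs : (v *m v^T)^T = v *m v^T.
Proof. by rewrite trmx_mul trmxK. Qed.

Let vvM : v *m v^T *m (v *m v^T) = v *m v^T.
Proof.
rewrite mulmxA -[v *m v^T *m v]mulmxA [v^T *m v]mx11_scalar -/(dot v v) v1.
by rewrite mulmx1.
Qed.

Lemma spike_root_sym : spike_root^T = spike_root.
Proof. by rewrite /spike_root linearD linearZ/= trmx1 vvs. Qed.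

Lemma spike_whitening_sym : spike_whitening^T = spike_whitening.
Proof. by rewrite /spike_whitening linearB linearZ/= trmx1 vvs. Qed.

Lemma spike_root_sqr :
  spike_root *m spike_root = (2 * g + g ^+ 2) *: (v *m v^T) + 1%:M.
Proof.
rewrite /spike_root mulmxDl mul1mx mulmxDr mulmx1 -scalemxAl -scalemxAr vvM.
by apply/matrixP => i j; rewrite !mxE; ring.
Qed.

Lemma spike_whiteningK : spike_whitening *m spike_root = 1%:M.
Proof.
rewrite /spike_root /spike_whitening mulmxBl mul1mx mulmxDr mulmx1.
rewrite -scalemxAl -scalemxAr vvM.
apply/matrixP => i j; rewrite !mxE; field; rewrite gt_eqF//.
by rewrite ltr_pwDl.
Qed.

Lemma spike_rootK : spike_root *m spike_whitening = 1%:M.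
Proof. exact: mulmx1C spike_whiteningK. Qed.

Lemma spike_rootE a : spike_root *m a = a + (g * dot v a) *: v.
Proof.
rewrite /spike_root mulmxDl mul1mx -scalemxAl -mulmxA [v^T *m a]mx11_scalar.
by rewrite -/(dot v a) mul_mx_scalar scalerA.
Qed.

(** Undoing the whitening gives [M = root (1 + E) root], and the root sends [a] to [a + g theta v]
    with [theta = dot v a]; the formula is the expansion of [1 + E] at that vector. *)
Lemma bil_unwhiten (M : 'M[R]_p) a :
  let E := spike_whitening *m M *m spike_whitening - 1%:M in
  E^T = E ->
  bil M a a = dot a a + bil E a a + 2 * g * dot v a * bil E a v +
    (2 * g + g ^+ 2 + g ^+ 2 * bil E v v) * dot v a ^+ 2.
Proof.
move=> E Es.
have ME : M = spike_root^T *m (1%:M + E) *m spike_root.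
  rewrite spike_root_sym /E addrC subrK !mulmxA spike_rootK mul1mx -mulmxA.
  by rewrite spike_whiteningK mulmx1.
rewrite [in LHS]ME bil_congr bilD bil1 spike_rootE.
set th := dot v a; rewrite -!bil1 !bilDl !bilDr !bilZl !bilZr !bil1 v1.
rewrite (bilC v a Es) (dotC a v) -/th; ring.
Qed.

End whitening.

(* For [s <= 1] the bound is polarization of the quadratic bound, which grows
   like [s ^ 2]; for [s >= 1] Cauchy-Schwarz for [1 + E] keeps it linear in [s]. *)
Lemma cross_form_le (R : realType) (p : nat) (E : 'M[R]_p) (v : 'cV[R]_p) :
  E^T = E -> (forall c, 0 <= dot c c + bil E c c) -> dot v v = 1 ->
  `|bil E v v| <= 2^-1 ->
  forall s, 0 <= s -> forall (S : {set 'I_p}),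
  (forall c, supported S c -> `|bil E c c| <= (30 * s + 450 * s ^+ 2) * dot c c) ->
  supported S v -> forall a, supported S a -> dot a a = 1 ->
  `|bil E a v| <= 480 * s.
Proof.
move=> Es G0 v1 dev_v s s_ge0 S rip Sv a Sa a1.
set delta := 30 * s + 450 * s ^+ 2 in rip.
have delta_ge0 : 0 <= delta by have := sqr_ge0 s; rewrite /delta; lra.
have [s1|s1] := leP s 1.
  (* The constant is [30 + 450], from [s ^ 2 <= s]. *)
  have -> : 480 * s = (delta + 450 * s * (1 - s)) / 2 * (dot a a + dot v v).
    by rewrite a1 v1 /delta; field.
  apply: (le_trans (bil_polar_le Es delta_ge0 rip Sa Sv)).
  rewrite ler_wpM2r ?addr_ge0 ?dot_ge0// ler_wpM2r ?invr_ge0//.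
  by have := mulr_ge0 s_ge0 (_ : 0 <= 1 - s); rewrite subr_ge0 => /(_ s1); lra.
have Gs : (1%:M + E)^T = 1%:M + E by rewrite linearD/= trmx1 Es.
have G0' c : 0 <= bil (1%:M + E) c c by rewrite bilD bil1.
have := bil_CauchySchwarz a v Gs G0'; rewrite !bilD !bil1 a1 v1 => CS.
have := rip a Sa; rewrite a1 mulr1 => ripa.
have av : `|dot a v| <= 1.
  have := @bil_CauchySchwarz _ _ 1%:M a v (trmx1 _ _).
  rewrite !bil1 a1 v1 mulr1 => h; rewrite -(@ler_pXn2r _ 2)// ?nnegrE//.
  by rewrite real_normK ?num_real// expr1n; apply: h => c; rewrite bil1 dot_ge0.
move: CS ripa dev_v av; rewrite /delta.
move: (bil E a v) (bil E a a) (bil E v v) (dot a v) => x y z t CS.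
rewrite !ler_norml => /andP[_ h1] /andP[h2 h3] /andP[h4 h5].
have ss : 1 <= s ^+ 2 by rewrite expr_ge1// ltW.
have h6 : 0 <= 1 + z by lra.
(* For [s >= 1], [1 + 30 s + 450 s^2 <= 481 s^2], and [1 + z <= 3/2]; the product stays below
   [900 s^2]. Removing [t], of size at most 1, leaves far less than [480 s]. *)
have : (t + x) ^+ 2 <= (30 * s) ^+ 2.
  apply: (le_trans CS); apply: (@le_trans _ _ (481 * s ^+ 2 * (3 / 2))); last first.
    by rewrite exprMn; lra.
  apply: (@le_trans _ _ (481 * s ^+ 2 * (1 + z))); last first.
    by apply: ler_wpM2l; lra.
  apply: ler_wpM2r => //.
  have : s <= s ^+ 2 by rewrite expr2 ler_peMr// ltW.
  lra.
have s30 : 0 <= 30 * s by lra.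
rewrite -[leLHS]real_normK ?num_real// ler_pXn2r ?nnegrE// ler_norml => /andP[h7 h8].
by apply/andP; split; lra.
Qed.

Section comparison.
Context (R : realType) (p k : nat) (v : 'cV[R]_p) (beta : R) (M : 'M[R]_p).
Hypotheses (k_gt0 : (0 < k)%N) (beta_gt0 : 0 < beta).
Hypothesis v_signal : ubspca_signal k v.
Hypotheses (Ms : M^T = M) (M_ge0 : forall a, 0 <= bil M a a).

Let r := Num.sqrt (1 + beta).
Let g := r - 1.
Let W := spike_whitening v g.
Let E := W *m M *m W - 1%:M.
Let Istar := vsupport v.

Let r_ge1 : 1 <= r.
Proof. by rewrite -sqrtr1 ler_wsqrtr// lerDl ltW. Qed.

Let rE : r ^+ 2 = 1 + beta.
Proof. by rewrite sqr_sqrtr//; have := beta_gt0; lra. Qed.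

Let g_ge0 : 0 <= g. Proof. by rewrite subr_ge0. Qed.

Let v1 : dot v v = 1.
Proof. by case: v_signal => h _ _; rewrite dotE -h; apply: eq_bigr => j _; rewrite expr2. Qed.

Lemma whitened_deviation_sym : E^T = E.
Proof.
by rewrite /E linearB/= trmx1 !trmx_mul Ms spike_whitening_sym mulmxA.
Qed.

Definition restriction (S : {set 'I_p}) : 'cV[R]_p := \col_j (if j \in S then v j 0 else 0).

Lemma restriction_supported S : supported S (restriction S).
Proof. by move=> j jS; rewrite mxE (negbTE jS). Qed.

Lemma dot_restriction S a : supported S a -> dot v a = dot (restriction S) a.
Proof.
move=> Sa; rewrite !dotE; apply: eq_bigr => j _; rewrite mxE.
by case: ifPn => // jS; rewrite Sa// !mulr0.
Qed.

Lemma dot_restriction_self S :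
  dot (restriction S) (restriction S) = #|S :&: Istar|%:R / k%:R.
Proof.
case: v_signal => _ _ h.
rewrite dotE (eq_bigr (fun j => (j \in S :&: Istar)%:R * k%:R^-1)) => [|j _].
  rewrite -mulr_suml -natr_sum -sum1_card [in RHS]big_mkcond/=.
  by congr (_%:R * _); apply: eq_bigr => j _; case: (_ \in _).
rewrite mxE inE; case: (j \in S) => /=; last by rewrite !mul0r.
have [jI|] := boolP (j \in Istar).
  by rewrite h// -invfM -expr2 sqr_sqrtr// mul1r.
by rewrite inE negbK => /eqP ->; rewrite !mul0r.
Qed.

Variable s : R.
Hypotheses (s_ge0 : 0 <= s).

Hypothesis rip : forall (S : {set 'I_p}) a, (#|S| <= 2 * k)%N -> supported S a ->
  `|bil E a a| <= (30 * s + 450 * s ^+ 2) * dot a a.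
Hypothesis dev_v : `|bil E v v| <= 2^-1.

Let Es := whitened_deviation_sym.

(** Both [a] and [v] live on [S :|: Istar], of size at most [2 k]; this is why the isometry is
    required at sparsity [2 k]. *)
Let cross (S : {set 'I_p}) a : #|S| = k -> supported S a -> dot a a = 1 ->
  `|bil E a v| <= 480 * s.
Proof.
move=> Sk Sa a1.
apply: (@cross_form_le _ _ E v Es _ v1 dev_v s s_ge0 (S :|: Istar)) => //.
- move=> c; have := M_ge0 (W *m c); rewrite -bil_congr spike_whitening_sym.
  by rewrite -[X in bil X](subrK 1%:M) bilD bil1 addrC.
- move=> c; apply: rip; rewrite (leq_trans (leq_card_setU _ _))// Sk.
  by case: v_signal => _ -> _; rewrite addnn -mul2n.
- by move=> j; rewrite inE negb_or => /andP[_]; rewrite inE negbK => /eqP.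
- by move=> j; rewrite inE negb_or => /andP[/Sa].
Qed.

Let g_le : g ^+ 2 <= beta.
Proof. by rewrite /g; have := rE; have := r_ge1; nra. Qed.

(** The effective strength of the spike: the part of the noise that scales with [beta] is absorbed
    here and does not enter [err]. *)
Let kap := beta + g ^+ 2 * bil E v v.

Let kap_ge : beta / 2 <= kap.
Proof.
have := g_le; have := sqr_ge0 g; move: dev_v; rewrite /kap ler_norml => /andP[h _].
by move: h; move: (bil E v v) (g ^+ 2) => y z; nra.
Qed.

Let err := 30 * s + 450 * s ^+ 2 + 2 * g * (480 * s).

Let dot_restriction_ge S a : supported S a -> dot a a = 1 ->
  dot v a ^+ 2 <= #|S :&: Istar|%:R / k%:R.
Proof.
move=> Sa a1; rewrite (dot_restriction Sa) -dot_restriction_self -bil1.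
rewrite (le_trans (bil_CauchySchwarz _ _ (trmx1 _ _) _))//.
  by move=> c; rewrite bil1 dot_ge0.
by rewrite !bil1 a1 mulr1.
Qed.

Let cardI_le1 (S : {set 'I_p}) : #|S| = k -> #|S :&: Istar|%:R / k%:R <= 1 :> R.
Proof.
move=> Sk; rewrite ler_pdivrMr ?ltr0n// mul1r ler_nat -Sk.
by rewrite subset_leq_card// subsetIl.
Qed.

Let spiked_deviation (S : {set 'I_p}) a :
  #|S| = k -> supported S a -> dot a a = 1 ->
  `|bil M a a - (1 + kap * dot v a ^+ 2)| <= err.
Proof.
move=> Sk Sa a1.
rewrite (bil_unwhiten v1 g_ge0 a Es) -/E a1.
have -> : 2 * g + g ^+ 2 = beta by rewrite /g; have := rE; lra.
rewrite -/kap.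
have -> : 1 + bil E a a + 2 * g * dot v a * bil E a v + kap * dot v a ^+ 2 -
   (1 + kap * dot v a ^+ 2) = bil E a a + 2 * g * (dot v a * bil E a v) by ring.
have Sk2 : (#|S| <= 2 * k)%N by rewrite Sk leq_pmull.
have := rip Sk2 Sa; rewrite a1 mulr1 => h.
rewrite (le_trans (ler_normD _ _))// lerD//.
have g20 : 0 <= 2 * g by have := g_ge0; lra.
rewrite normrM (ger0_norm g20) ler_wpM2l// normrM -[leRHS]mul1r.
apply: ler_pM => //; last exact: (cross Sk Sa a1).
rewrite -(ler_pXn2r (ltn0Sn 1)) ?nnegrE// real_normK ?num_real// expr1n.
by rewrite (le_trans (dot_restriction_ge Sa a1))// cardI_le1.
Qed.

(** If the conclusion failed, the upper bound for [J] would also hold at a test vector on [I], so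
    [kap] times the gap would be at most [2 * err]. With [kap >= beta / 2] this gives [beta] times
    the gap at most [4 * err], and [5760 = 4 * (30 + 450 + 960)] once [s], [s ^ 2] and [g * s] are
    each bounded by [r * s]. *)
Lemma lambda1_compare (I J : {set 'I_p}) : #|I| = k -> #|J| = k -> s <= r ->
  5760 * r * s < beta * ((#|I :&: Istar|%:R - #|J :&: Istar|%:R) / k%:R) ->
  lambda1 (principal_submx J M) < lambda1 (principal_submx I M).
Proof.
move=> Ik Jk sr; rewrite mulrBl.
pose mS (S : {set 'I_p}) : R := #|S :&: Istar|%:R / k%:R.
rewrite -/(mS I) -/(mS J) => gap.
rewrite ltNge; apply/negP => IJ.
have ub : lambda1 (principal_submx J M) <= 1 + kap * mS J + err.
  apply/lambda1_principal_le => //; first by rewrite Jk.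
  apply: bil_le_unit => a Ja a1.
  have := spiked_deviation Jk Ja a1; rewrite ler_norml => /andP[_ h].
  have : kap * dot v a ^+ 2 <= kap * mS J.
    rewrite ler_wpM2l ?dot_restriction_ge// (le_trans _ kap_ge)//.
    by have := beta_gt0; lra.
  by move: h; move: (kap * _ ^+ 2) => y; lra.
have mJ : 0 <= mS J by rewrite divr_ge0.
have rs0 : 0 <= r * s by rewrite mulr_ge0// (le_trans ler01).
have mI : 0 < mS I.
  have : 0 < beta * (mS I - mS J) by apply: le_lt_trans gap; lra.
  by rewrite pmulr_rgt0// subr_gt0; exact: le_lt_trans.
have {IJ ub} := le_trans IJ ub.
move/lambda1_principal_le => /(_ Ms); rewrite Ik => /(_ k_gt0) h.
pose sq := Num.sqrt (mS I).
have sq0 : 0 < sq by rewrite sqrtr_gt0.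
have sqE : mS I = sq ^+ 2 by rewrite sqr_sqrtr// ltW.
(* The normalized restriction of [v] to [I] attains equality in the Cauchy-Schwarz bound on
   [dot v a ^+ 2]. *)
pose b := sq^-1 *: restriction I.
have Ib : supported I b by move=> j jI; rewrite mxE restriction_supported// mulr0.
have dvb : dot v b = sq.
  rewrite (dot_restriction Ib) /b -bil1 bilZr bil1 dot_restriction_self -/(mS I).
  by rewrite sqE; field; rewrite gt_eqF.
have b1 : dot b b = 1.
  rewrite /b -bil1 bilZl bilZr bil1 dot_restriction_self -/(mS I) sqE.
  by field; rewrite gt_eqF.
have := spiked_deviation Ik Ib b1; rewrite ler_norml dvb -sqE => /andP[h1 _].
have := h b Ib; rewrite b1 mulr1 => h2.
have h3 : kap * (mS I - mS J) <= 2 * err by lra.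
have : beta / 2 * (mS I - mS J) <= kap * (mS I - mS J).
  apply: ler_wpM2r kap_ge.
  have : 0 < beta * (mS I - mS J) by apply: le_lt_trans gap; lra.
  by rewrite pmulr_rgt0// => /ltW.
have ssr : s ^+ 2 <= r * s by rewrite expr2 ler_wpM2r.
have srs : s <= r * s by rewrite ler_peMl.
have : 4 * err <= 5760 * r * s.
  by have := s_ge0; rewrite /err /g; lra.
lra.
Qed.

End comparison.

(** * The sample covariance *)

Section integer_vectors.
Context (R : realType) (p : nat).

Definition int_vector (S : {set 'I_p}) (z : {ffun 'I_p -> int}) : 'cV[R]_p :=
  \col_j (if j \in S then (z j)%:~R else 0).

(* The inequality is homogeneous, so that integer points detect it: [floor (N a)]
   differs from [N a] by a bounded vector. *)
Lemma bil_le_int_vector (S : {set 'I_p}) (A : 'M[R]_p) (m : R) :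
  (forall a, supported S a -> bil A a a <= m * dot a a) <->
  (forall z, bil A (int_vector S z) (int_vector S z) <=
    m * dot (int_vector S z) (int_vector S z)).
Proof.
split=> [h z|h a Sa]; first by apply: h => j jS; rewrite mxE (negbTE jS).
pose B := m%:M - A.
have B0 z : 0 <= bil B (int_vector S z) (int_vector S z).
  by rewrite bilB bil_scalar subr_ge0.
rewrite -subr_ge0 -bil_scalar -bilB -/B leNgt; apply/negP => aneg.
have [K K0 hK] := bil_le_coord B.
pose s := Num.sqrt (dot a a).
have s0 : 0 <= s by exact: sqrtr_ge0.
(* With [e] the rounding error of [N a], the form at the integer point is at most
   [N^2 B(a, a) + 2 N K s + K]. This is negative as soon as [N] exceeds [C]. *)
pose C := (2 * K * s + K) / - bil B a a.
have C0 : 0 <= C by rewrite divr_ge0 ?oppr_ge0 ?(ltW aneg)// addr_ge0// !mulr_ge0.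
pose N : R := (Num.truncn C).+1%:R.
have CN : C < N by exact: truncnS_gt.
have N1 : 1 <= N by rewrite ler1n.
pose z : {ffun 'I_p -> int} := [ffun j => Num.floor (N * a j 0)].
pose e := N *: a - int_vector S z.
have e1 j : `|e j 0| <= 1.
  rewrite !mxE; case: ifPn => [_|jS]; last by rewrite Sa// mulr0 subr0 normr0.
  rewrite ffunE; have /andP[f1 f2] := floor_itv (N * a j 0).
  rewrite ger0_norm ?subr_ge0// lerBlDl ltW//.
  by move: f2; rewrite intrD.
have := B0 z; have -> : int_vector S z = N *: a - e by rewrite /e subKr.
clearbody e.
rewrite bilDl bilNl !bilDr !bilNr !bilZl !bilZr.
have := hK a e s 1 (coord_le_dot a) e1; have := hK e a 1 s e1 (coord_le_dot a).
have := hK e e 1 1 e1 e1; rewrite !mul1r !mulr1.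
rewrite !ler_norml => /andP[_ h1] /andP[h2 _] /andP[h3 _] h4.
have : (2 * K * s + K) < N * - bil B a a by rewrite -ltr_pdivrMr// oppr_gt0.
move: (bil B a a) (bil B a e) (bil B e a) (bil B e e) h1 h2 h3 h4 => y1 y2 y3 y4 h1 h2 h3 h4 h5.
have h6 : N * (2 * K * s + K) < N * (N * - y1) by rewrite ltr_pM2l// (lt_le_trans ltr01).
have h7 : N * (- y2) <= N * (K * s) by rewrite ler_pM2l ?(lt_le_trans ltr01)//; lra.
have h8 : N * (- y3) <= N * (K * s) by rewrite ler_pM2l ?(lt_le_trans ltr01)//; lra.
have h9 : K <= N * K by rewrite ler_peMl.
lra.
Qed.

End integer_vectors.

Section sample_forms.
Context (R : realType) (d : measure_display) (T : measurableType d).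
Variables (P : probability T R) (n p : nat) (x : 'I_n -> {RV P >-> p.-tuple R}).

Let Sigma w := sample_covariance (data_matrix x w).

Lemma sample_covariance_sym w : (Sigma w)^T = Sigma w.
Proof. by rewrite /Sigma/sample_covariance linearZ/= trmx_mul trmxK. Qed.

Lemma bil_sample_covariance w a : bil (Sigma w) a a =
  n%:R^-1 * \sum_(i < n) (\sum_(j < p) a j 0 * tnth (x i w) j) ^+ 2.
Proof.
rewrite /Sigma /sample_covariance /bil -scalemxAr -scalemxAl mxE; congr (_ * _).
rewrite mulmxA -trmx_mul -mulmxA -/(dot _ _) dotE; apply: eq_bigr => i _.
rewrite expr2 mxE; congr (_ * _); apply: eq_bigr => j _; by rewrite mxE mulrC.
Qed.

Lemma bil_sample_covariance_ge0 w a : 0 <= bil (Sigma w) a a.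
Proof.
rewrite bil_sample_covariance mulr_ge0 ?invr_ge0 ?ler0n// sumr_ge0// => i _.
exact: sqr_ge0.
Qed.

Lemma measurable_linear_form (a : 'cV[R]_p) :
  measurable_fun setT (fun y : p.-tuple R => \sum_(j < p) a j 0 * tnth y j).
Proof.
apply: measurable_sum => j; apply: measurable_funM => //; exact: measurable_tnth.
Qed.

Lemma measurable_bil_sample_covariance a :
  measurable_fun setT (fun w => bil (Sigma w) a a).
Proof.
under eq_fun do rewrite bil_sample_covariance.
apply: measurable_funM => //; apply: measurable_sum => i; apply: measurable_funX.
by apply: (measurableT_comp (measurable_linear_form a)).
Qed.

(** By the Rayleigh characterization tested on integer vectors, the event is a countable
    intersection of events about single quadratic forms. *)
Lemma measurable_lambda1_le (S : {set 'I_p}) (m : R) : (0 < #|S|)%N ->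
  measurable [set w | lambda1 (principal_submx S (Sigma w)) <= m].
Proof.
move=> S0.
pose F (i : nat) : set T := if @unpickle {ffun 'I_p -> int} i is Some z then
  [set w | bil (Sigma w) (int_vector R S z) (int_vector R S z) <=
    m * dot (int_vector R S z) (int_vector R S z)] else setT.
rewrite (_ : mkset _ = \bigcap_i F i).
  apply: bigcapT_measurable => i; rewrite /F; case: unpickle => [z|//].
  rewrite -[X in measurable X]setTI; apply: measurable_fun_le => //.
  exact: measurable_bil_sample_covariance.
apply/seteqP; split=> w /=.
  move=> /(lambda1_principal_le m (sample_covariance_sym w) S0)/bil_le_int_vector h i _.
  by rewrite /F; case: unpickle.
move=> h; apply/(lambda1_principal_le m (sample_covariance_sym w) S0)/bil_le_int_vector => z.
by have := h (pickle z) I; rewrite /F pickleK.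
Qed.

Lemma measurable_lambda1_lt (I J : {set 'I_p}) : (0 < #|I|)%N -> (0 < #|J|)%N ->
  measurable [set w | lambda1 (principal_submx J (Sigma w)) <
    lambda1 (principal_submx I (Sigma w))].
Proof.
move=> I0 J0.
rewrite (_ : mkset _ = \bigcup_(c : rat)
  ([set w | lambda1 (principal_submx J (Sigma w)) <= ratr c] `\`
   [set w | lambda1 (principal_submx I (Sigma w)) <= ratr c])).
  by apply: bigcupT_measurable_rat => c; apply: measurableD; exact: measurable_lambda1_le.
apply/seteqP; split=> w /=.
  move=> /rat_in_itvoo[c]; rewrite in_itv/= => /andP[h1 h2].
  by exists c => //; split; [exact: ltW|apply/negP; rewrite -ltNge].
by move=> [c _ [h1 /negP]]; rewrite -ltNge; exact: le_lt_trans.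
Qed.

End sample_forms.

Lemma measure_exists_le d (T : measurableType d) (R : realType)
    (P : probability T R) (I : finType) (F : I -> set T) (c : R) :
  (forall i, measurable (F i)) -> (forall i, P (F i) <= c%:E)%E ->
  measurable [set w | exists i, F i w] /\
  (P [set w | exists i, F i w] <= (#|I|%:R * c)%:E)%E.
Proof.
move=> mF Fc.
have -> : [set w | exists i, F i w] = \big[setU/set0]_(i <- enum I) F i.
  rewrite -bigcup_seq; apply/seteqP; split => w /= [i].
    by move=> Fi; exists i => //=; rewrite mem_enum.
  by move=> _ Fi; exists i.
split; first by apply: bigsetU_measurable.
rewrite cardE; elim: (enum I) => [|i s IH].
  by rewrite big_nil measure0 mul0r.
rewrite big_cons (le_trans (measureU2 _ _ _))//; first exact: bigsetU_measurable.
by rewrite /= -nat1r mulrDl mul1r EFinD leeD.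
Qed.

(** * High-probability events for the whitened deviation *)

Section high_probability.
Context (R : realType) (d : measure_display) (T : measurableType d).
Variables (P : probability T R) (n p k : nat) (beta : R) (v : 'cV[R]_p).
Variable x : 'I_n -> {RV P >-> p.-tuple R}.
Hypotheses (n_gt0 : (0 < n)%N) (k_gt0 : (0 < k)%N) (beta_gt0 : 0 < beta).
Hypothesis v_signal : ubspca_signal k v.
Hypothesis x_samples : ubspca_samples beta v x.

Let r := Num.sqrt (1 + beta).
Let W := spike_whitening v (r - 1).
Let Sigma w := sample_covariance (data_matrix x w).
Let E w := W *m Sigma w *m W - 1%:M.

Let v1 : dot v v = 1.
Proof. by case: v_signal => h _ _; rewrite dotE -h; apply: eq_bigr => j _; rewrite expr2. Qed.

Let rE : r ^+ 2 = 1 + beta.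
Proof. by rewrite sqr_sqrtr//; have := beta_gt0; lra. Qed.

Let r1_ge0 : 0 <= r - 1.
Proof. by rewrite subr_ge0 -sqrtr1 ler_wsqrtr// lerDl ltW. Qed.

Let bil_E w b : bil (E w) b b =
  n%:R^-1 * (\sum_(i < n) (\sum_(j < p) (W *m b) j 0 * tnth (x i w) j) ^+ 2) - dot b b.
Proof.
by rewrite /E bilB bil1 -{1}[W](spike_whitening_sym v (r - 1)) bil_congr bil_sample_covariance.
Qed.

Let whitened_variance b :
  ((W *m b)^T *m (beta *: (v *m v^T) + 1%:M) *m (W *m b)) 0 0 = dot b b.
Proof.
rewrite -/(bil _ _ _) -bil_congr spike_whitening_sym.
have -> : beta = 2 * (r - 1) + (r - 1) ^+ 2 by have := rE; lra.
rewrite -spike_root_sqr// !mulmxA spike_whiteningK// mul1mx spike_rootK//.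
exact: bil1.
Qed.

(** The linear form of a sample along [W *m b] has variance [dot b b], so the tail is free of
    [beta]. The bound [dot b b <= 2] is the variance condition of the Chernoff estimate. *)
Lemma whitened_deviation_tail b u : dot b b <= 2 -> 0 < u ->
  measurable [set w | u <= `|bil (E w) b b|] /\
  (P [set w | (u <= `|bil (E w) b b|)%R] <=
    (2 * expR (- (n%:R * (u * Num.min u 1)) / 32))%:E)%E.
Proof.
move=> b2 u0.
pose l (y : p.-tuple R) := \sum_(j < p) (W *m b) j 0 * tnth y j.
have ml : measurable_fun setT l by exact: measurable_linear_form.
have -> : [set w | u <= `|bil (E w) b b|] =
    [set w | u <= `|n%:R^-1 * (\sum_(i < n) l (x i w) ^+ 2) - dot b b|].
  by apply/seteqP; split => w /=; rewrite bil_E.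
split.
  rewrite -[X in measurable X]setTI; apply: measurable_fun_le => //.
  apply: measurableT_comp => //; apply: measurable_funB => //.
  by apply: measurable_funM => //; exact: measurable_sum_sqr_rv.
case: x_samples => indep gauss.
apply: sum_sqr_gaussian_tail => //; first exact: dot_ge0.
move=> i A mA; have := gauss i (W *m b) A mA.
by rewrite mulmx0 mxE whitened_variance.
Qed.

(** At most [2 k] coordinates, each off by [1 / L], give a squared distance of at most
    [2 k / (16 k)^2 <= 1/64], the mesh that [bil_net_bound] asks for. *)
Let L := (16 * k)%N.

(** One exceptional set [B] serves all supports at once, because the grid runs over all sequences of
    [2 k] indices; the factor in front of the tail counts its points. *)
Lemma sparse_isometry_whp u : 0 < u -> exists2 B : set T,
  measurable B /\
  (P B <= ((p * (L.*2.+1)) ^ (2 * k))%:R%:E *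
     (2 * expR (- (n%:R * (u * Num.min u 1)) / 32))%:E)%E &
  forall w, ~ B w -> forall (S : {set 'I_p}) a, (#|S| <= 2 * k)%N -> supported S a ->
    `|bil (E w) a a| <= 2 * u * dot a a.
Proof.
move=> u0.
have L0 : (0 < L)%N by rewrite muln_gt0.
pose I := {ffun 'I_(2 * k) -> 'I_p * 'I_(L.*2.+1)}.
pose gv (f : I) : 'cV[R]_p := grid_vector R f.
(* Grid vectors too long for the tail bound get the empty event; they never approximate a unit
   vector. *)
pose F (f : I) : set T := if dot (gv f) (gv f) <= 2 then
  [set w | u <= `|bil (E w) (gv f) (gv f)|] else set0.
have mF f : measurable (F f).
  by rewrite /F; case: ifP => // f2; case: (whitened_deviation_tail f2 u0).
have PF f : (P (F f) <= (2 * expR (- (n%:R * (u * Num.min u 1)) / 32))%:E)%E.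
  rewrite /F; case: ifP => [f2|_]; first by case: (whitened_deviation_tail f2 u0).
  by rewrite measure0 lee_fin mulr_ge0// expR_ge0.
exists [set w | exists f, F f w].
  have := measure_exists_le mF PF.
  by rewrite card_ffun card_prod !card_ord EFinM.
move=> w wB S a Sk Sa.
have Es : (E w)^T = E w by apply: whitened_deviation_sym; exact: sample_covariance_sym.
apply: (bil_net_bound Es (ltW u0) _ Sa) => {Sa}a Sa a1.
have [f [Sf fa]] := grid_vector_approx L0 Sk Sa a1.
exists (gv f).
have dE j : (a - gv f) j 0 = a j 0 - gv f j 0 by rewrite mxE [X in _ + X]mxE.
have close : dot (a - gv f) (a - gv f) <= 64^-1.
  rewrite dotE (bigID (mem S))/= [X in _ + X]big1 ?addr0 => [|j jS]; last first.
    by rewrite dE Sa// (Sf _ jS) subrr mul0r.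
  apply: (@le_trans _ _ (\sum_(j in S) (L%:R^-1 ^+ 2))).
    apply: ler_sum => j _; rewrite -expr2 -[leLHS]real_normK ?num_real//.
    by rewrite lerXn2r ?nnegrE ?invr_ge0 ?ler0n//; rewrite dE; exact: fa.
  rewrite sumr_const -[leLHS]mulr_natr mulrC.
  have k0 : 1 <= k%:R :> R by rewrite ler1n.
  have Sk' : #|S|%:R <= 2 * k%:R :> R by rewrite -natrM ler_nat.
  rewrite exprVn ler_pdivrMr ?exprn_gt0 ?ltr0n// natrM.
  by rewrite (le_trans Sk')//; nra.
split => //.
rewrite leNgt; apply/negP => uf; apply: wB; exists f; rewrite /F ifT /=; first exact: ltW.
(* With [e = a - gv f], this square bounds [- dot a e] by [1/4 + dot e e], so the grid vector has
   squared norm at most [3/2 + 3/64]. *)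
have := dot_ge0 (a + 2 *: (a - gv f)); move: close.
have -> : dot (gv f) (gv f) = dot (a - (a - gv f)) (a - (a - gv f)) by rewrite subKr.
set e := a - gv f; clearbody e.
rewrite -!bil1 !bilDl !bilDr !bilNl !bilNr !bilZl !bilZr !bil1 (dotC e a) a1; lra.
Qed.

Lemma measurable_comparison (xi : R) : measurable [set w |
       (let Istar := vsupport v in
        let Sigma := sample_covariance (data_matrix x w) in
        forall I J : {set 'I_p}, #|I| = k -> #|J| = k ->
          #|I :&: Istar|%:R - #|J :&: Istar|%:R > xi * k%:R ->
          lambda1 (principal_submx I Sigma) > lambda1 (principal_submx J Sigma))%R].
Proof.
set G := (X in measurable X).
rewrite (_ : G = \bigcap_(IJ in [set IJ : {set 'I_p} * {set 'I_p} |
   [/\ #|IJ.1| = k, #|IJ.2| = k & xi * k%:R < #|IJ.1 :&: vsupport v|%:R - #|IJ.2 :&: vsupport v|%:R]])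
     [set w | lambda1 (principal_submx IJ.2 (Sigma w)) < lambda1 (principal_submx IJ.1 (Sigma w))]).
  apply: fin_bigcap_measurable; first exact: finite_finset.
  by move=> [I J]/= [Ik Jk _]; apply: measurable_lambda1_lt; rewrite ?Ik ?Jk.
apply/seteqP; split => w /= h.
  by move=> [I J]/= [Ik Jk IJ]; exact: h.
by move=> I J Ik Jk IJ; apply: (h (I, J)).
Qed.

(** Two exceptional events are discarded: failure of the sparse isometry at level [u], and
    [|E(v, v)| >= 1/2]. The latter is the tail at [u = 1/2], with exponent
    [n / 4 / 32 = n / 128]. *)
Lemma comparison_whp (xi s : R) : 0 < s -> s <= r -> 5760 * r * s <= beta * xi ->
  ((1 - (((p * (L.*2.+1)) ^ (2 * k))%:R *
     (2 * expR (- (n%:R * ((15 * s + 225 * s ^+ 2) * Num.min (15 * s + 225 * s ^+ 2) 1)) / 32))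
     + 2 * expR (- n%:R / 128)))%:E <=
  P [set w |
       (let Istar := vsupport v in
        let Sigma := sample_covariance (data_matrix x w) in
        forall I J : {set 'I_p}, #|I| = k -> #|J| = k ->
          #|I :&: Istar|%:R - #|J :&: Istar|%:R > xi * k%:R ->
          lambda1 (principal_submx I Sigma) > lambda1 (principal_submx J Sigma))%R])%E.
Proof.
move=> s0 sr gap; set u := 15 * s + 225 * s ^+ 2; set G := (X in P X).
have u0 : 0 < u by rewrite /u; have := exprn_gt0 2 s0; lra.
have mG : measurable G by exact: measurable_comparison.
have [B1 [mB1 PB1] hB1] := sparse_isometry_whp u0.
have v2 : dot v v <= 2 by rewrite v1; lra.
have half0 : 0 < 2^-1 :> R by lra.
have [mB2 PB2] := whitened_deviation_tail v2 half0.
set B2 := (X in P X) in PB2.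
have BG : ~` (B1 `|` B2) `<=` G.
  move=> w /= /not_orP[wB1 wB2]; rewrite /G/= => I J Ik Jk IJ.
  apply: (@lambda1_compare _ _ _ _ _ _ k_gt0 beta_gt0 v_signal _ _ s) => //.
  - exact: sample_covariance_sym.
  - exact: bil_sample_covariance_ge0.
  - exact: ltW.
  - move=> S a Sk Sa; have := hB1 w wB1 S a Sk Sa.
    by have -> : 2 * u = 30 * s + 450 * s ^+ 2 by rewrite /u; ring.
  - by rewrite leNgt; apply/negP => h; apply: wB2; exact: ltW.
  - rewrite (le_lt_trans gap)// ltr_pM2l// ltr_pdivlMr// ltr0n//.
apply: (@le_trans _ _ (P (~` (B1 `|` B2)))); last first.
  by apply: le_measure => //; rewrite inE//; apply: measurableC; exact: measurableU.
rewrite probability_setC; last exact: measurableU.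
rewrite EFinB leeB// EFinD (le_trans (measureU2 _ mB1 mB2))// leeD//.
apply: (le_trans PB2); rewrite lee_fin ler_pM2l// ler_expR.
by rewrite min_l; lra.
Qed.

End high_probability.

(** * Choice of constants and passage to the limit *)

Lemma grid_union_bound (R : realType) (n p k : nat) (s u : R) :
  (0 < n)%N -> (0 < k)%N -> (k <= p)%N -> (33 <= p)%N -> 0 < s ->
  s ^+ 2 = k%:R * ln p%:R / n%:R ->
  u = 15 * s + 225 * s ^+ 2 ->
  ((p * ((16 * k).*2.+1)) ^ (2 * k))%:R *
    (2 * expR (- (n%:R * (u * Num.min u 1)) / 32)) <=
  2 * expR (- (k%:R * ln p%:R)).
Proof.
move=> n0 k0 kp p33 s0 sE uE.
have n0' : 0 < n%:R :> R by rewrite ltr0n.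
have p0 : (0 < p)%N by exact: leq_trans p33.
(* The two terms of [u] serve the two ranges: [15 s] gives the bound when [u <= 1], and [225 s^2]
   when [u > 1]. *)
have u2 : 225 * s ^+ 2 <= u * Num.min u 1.
  have s2 := exprn_gt0 2 s0.
  have u0 : 0 < u by rewrite uE; lra.
  rewrite minEle; case: ifP => _; last by rewrite uE; lra.
  have -> : 225 * s ^+ 2 = (15 * s) * (15 * s) by ring.
  by apply: ler_pM; lra.
(* Here [32 k + 1 <= 33 k <= 33 p <= p^2], so each of the [2 k] slots has at most [p^3] values; this
   is the use of [33 <= p]. *)
have card : (((p * ((16 * k).*2.+1)) ^ (2 * k))%N%:R : R) <= expR (6 * (k%:R * ln p%:R)).
  apply: (@le_trans _ _ ((p ^ 3) ^ (2 * k))%N%:R).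
    rewrite ler_nat leq_exp2r ?muln_gt0// expnS leq_mul2l; apply/orP; right.
    have : ((16 * k).*2.+1 <= 33 * p)%N.
      by rewrite -muln2; apply: (@leq_trans (33 * k)); [lia|rewrite leq_mul2l kp orbT].
    by move=> h; rewrite (leq_trans h)// expnS expn1 leq_mul2r p33 orbT.
  rewrite -expnM natrX -[X in X ^+ _]lnK ?posrE ?ltr0n// -expRM_natl ler_expR.
  by rewrite !natrM; lra.
(* The constant 225 is chosen because [225 / 32 > 7]: the tail exponent exceeds the entropy
   [6 k ln p] of the net by at least [k ln p]. *)
have key : 7 * (k%:R * ln p%:R) <= (n%:R * (u * Num.min u 1)) / 32.
  have : n%:R * (225 * s ^+ 2) <= n%:R * (u * Num.min u 1) by rewrite ler_pM2l.
  have -> : n%:R * (225 * s ^+ 2) = 225 * (k%:R * ln p%:R).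
    by rewrite sE; field; rewrite gt_eqF.
  have : 0 <= k%:R * ln (p%:R : R) by rewrite mulr_ge0// ln_ge0// ler1n.
  lra.
rewrite mulrCA ler_pM2l//.
have -> : - (k%:R * ln p%:R) = 6 * (k%:R * ln p%:R) + - (7 * (k%:R * ln p%:R)) :> R by ring.
by rewrite expRD ler_pM ?ler0n ?expR_ge0// ler_expR mulNr lerN2.
Qed.

Lemma comparison_whp_asymptotic (R : realType) (d : measure_display)
    (T : measurableType d) (P : probability T R) (n p k : nat)
    (beta k_info c xi : R) (v : 'cV[R]_p) (x : 'I_n -> {RV P >-> p.-tuple R}) :
  (0 < n)%N -> (0 < k)%N -> (33 <= p)%N -> 1 <= ln (p%:R : R) -> 0 < beta -> 0 < c ->
  0 < k_info <= 2 * c * (beta ^+ 2 * n%:R / ln (p%:R : R)) ->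
  5760 * Num.sqrt (2 * c) * Num.sqrt ((1 + beta) * k%:R / k_info) <= xi ->
  ubspca_signal k v -> ubspca_samples beta v x ->
  ((1 - (2 * expR (- k%:R) + 2 * expR (- n%:R / 128)))%:E <=
  P [set w |
       (let Istar := vsupport v in
        let Sigma := sample_covariance (data_matrix x w) in
        forall I J : {set 'I_p}, #|I| = k -> #|J| = k ->
          #|I :&: Istar|%:R - #|J :&: Istar|%:R > xi * k%:R ->
          lambda1 (principal_submx I Sigma) > lambda1 (principal_submx J Sigma))%R])%E.
Proof.
move=> n0 k0 p33 lnp1 beta0 c0 /andP[ki0 kiu] xi_ge vsig xsam.
have n0' : 0 < n%:R :> R by rewrite ltr0n.
have k0' : 0 < k%:R :> R by rewrite ltr0n.
have lnp0 : 0 < ln (p%:R : R) by lra.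
have kp : (k <= p)%N.
  by case: vsig => _ <- _; rewrite -[leqRHS](card_ord p) max_card.
have [xi1|xi1] := leP 1 xi.
  rewrite (_ : [set w | _] = setT); last first.
    apply/seteqP; split => // w _ /= I J Ik Jk; rewrite ltNge => /negP[].
    rewrite (@le_trans _ _ k%:R) ?ler_peMl// lerBlDr (@le_trans _ _ #|I|%:R)//.
      by rewrite ler_nat subset_leq_card// subsetIl.
    by rewrite Ik lerDl.
  rewrite probability_setT lee_fin gerBl addr_ge0// mulr_ge0// expR_ge0//.
pose s := Num.sqrt (k%:R * ln p%:R / n%:R : R).
have s0 : 0 < s by rewrite sqrtr_gt0 divr_gt0// mulr_gt0.
have sE : s ^+ 2 = k%:R * ln p%:R / n%:R by rewrite sqr_sqrtr// ltW// divr_gt0// mulr_gt0.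
pose r := Num.sqrt (1 + beta).
have b10 : 0 < 1 + beta by lra.
have r0 : 0 < r by rewrite sqrtr_gt0.
have rE : r ^+ 2 = 1 + beta by rewrite sqr_sqrtr// ltW.
(* The upper bound on [k_info] makes [sqrt ((1 + beta) k / k_info)] at least [r s / (beta q)];
   multiplying by [5760 q] and by [beta] gives the gap. *)
have gap : 5760 * r * s <= beta * xi.
  pose q := Num.sqrt (2 * c).
  have q0 : 0 < q by rewrite sqrtr_gt0; lra.
  have qE : q ^+ 2 = 2 * c by rewrite sqr_sqrtr//; lra.
  have : r * s / (beta * q) <= Num.sqrt ((1 + beta) * k%:R / k_info).
    rewrite -[leLHS]ger0_norm; last by rewrite ltW// divr_gt0// mulr_gt0.
    rewrite -sqrtr_sqr ler_wsqrtr// expr_div_n !exprMn rE sE qE.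
    have -> : (1 + beta) * (k%:R * ln p%:R / n%:R) / (beta ^+ 2 * (2 * c)) =
        (1 + beta) * k%:R / (2 * c * (beta ^+ 2 * n%:R / ln (p%:R : R))).
      by field; rewrite !gt_eqF.
    apply: ler_wpM2l; first by rewrite ltW// mulr_gt0.
    rewrite lef_pV2// posrE; first exact: lt_le_trans kiu.
  rewrite ler_pdivrMr ?mulr_gt0// => h.
  have h1 : beta * (5760 * q * Num.sqrt ((1 + beta) * k%:R / k_info)) <= beta * xi.
    by rewrite ler_pM2l.
  by move: h h1; move: (Num.sqrt (_ / k_info)) => y; lra.
(* As [xi < 1] here, the gap yields [5760 r s <= beta <= r^2]. *)
have sr : s <= r.
  rewrite -(ler_pM2r r0) -expr2 rE.
  have h1 : beta * xi <= beta * 1 by rewrite ler_pM2l// ltW.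
  have h2 : 0 <= r * s by rewrite ltW// mulr_gt0.
  lra.
apply: le_trans (comparison_whp n0 k0 beta0 vsig xsam s0 sr gap).
rewrite lee_fin lerD2l lerN2 lerD2r.
apply: (le_trans (grid_union_bound n0 k0 kp p33 s0 sE erefl)).
by rewrite ler_pM2l// ler_expR lerN2 ler_peMr// ltW.
Qed.

Theorem corollary4p4 (R : realType) (n p k : nat -> nat)
    (beta k_info : nat -> R) (c : R)
    (n_oo : n m @[m --> \oo] --> \oo)
    (p_oo : p m @[m --> \oo] --> \oo)
    (k_oo : k m @[m --> \oo] --> \oo)
    (beta_gt0 : forall m, 0 < beta m)
    (c_gt0 : 0 < c)
    (pn_c : ((p m)%:R / (n m)%:R : R) @[m --> \oo] --> c)
    (k_infoE :
      asymp k_info (fun m => beta m ^+ 2 * (n m)%:R / ln ((p m)%:R : R))) :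
  exists2 xi : nat -> R,
    xi = (fun m => (k m)%:R^-1)%R
         +O_\oo (fun m => Num.sqrt ((1 + beta m) * (k m)%:R / k_info m)) &
    forall (v : forall m, 'cV[R]_(p m))
      (d : nat -> measure_display) (T : forall m, measurableType (d m))
      (P : forall m, probability (T m) R)
      (x : forall m, 'I_(n m) -> {RV (P m) >-> (p m).-tuple R}),
      (forall m, ubspca_signal (k m) (v m)) ->
      (forall m, ubspca_samples (beta m) (v m) (x m)) ->
      P m [set w |
        let Istar := vsupport (v m) in
        let Sigma := sample_covariance (data_matrix (x m) w) in
        forall I J : {set 'I_(p m)}, #|I| = k m -> #|J| = k m ->
          #|I :&: Istar|%:R - #|J :&: Istar|%:R > xi m * (k m)%:R ->
          lambda1 (principal_submx I Sigma) > lambda1 (principal_submx J Sigma)]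
        @[m --> \oo] --> 1%E.
Proof.
have [c' c'0 ratio] := k_infoE.
(* The factor [2 * c'] reflects that [k_info] is eventually at most twice its limiting multiple of
   [beta^2 n / ln p]. The choice involves the parameters only, not the signal or the samples. *)
exists (fun m => (k m)%:R^-1 + 5760 * Num.sqrt (2 * c') *
    Num.sqrt ((1 + beta m) * (k m)%:R / k_info m)).
  apply/eqaddOP; near=> K.
  have KE : 5760 * Num.sqrt (2 * c') <= K.
    by near: K; apply: nbhs_pinfty_ge; rewrite num_real.
  apply: nearW => m.
  rewrite /= addrAC subrr add0r normrM ler_wpM2r// ger0_norm ?mulr_ge0//.
move=> v d T P x vsig xsam.
apply: (@squeeze_cvge _ _ _ _
  (fun m => (1 - (2 * expR (- (k m)%:R) + 2 * expR (- (n m)%:R / 128)))%:E) _ (cst 1%E)); last 2 first.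
- have nat_oo (f : nat -> nat) : f m @[m --> \oo] --> \oo -> ((f m)%:R : R) @[m --> \oo] --> +oo.
    by move=> h; apply/cvgrnyP.
  apply: cvg_EFin; first exact: nearW.
  rewrite -[X in _ --> X](_ : 1 - (2 * 0 + 2 * 0) = 1 :> R); last by ring.
  apply: cvgB; first exact: cvg_cst.
  apply: cvgD; (apply: cvgM; first exact: cvg_cst).
    exact: (cvg_comp _ _ (nat_oo _ k_oo) (@cvgr_expR R)).
  under eq_fun do rewrite mulNr.
  apply: (cvg_comp (fun m => (n m)%:R / 128) _ _ (@cvgr_expR R)).
  have /cvgryPge noo := nat_oo _ n_oo; apply/cvgryPge => A.
  by apply: filterS (noo (A * 128)) => m; rewrite ler_pdivlMr.
- exact: cvg_cst.
near=> m.
have n0 : (0 < n m)%N by near: m; exact: (n_oo _ (nbhs_infty_gt 0)).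
have k0 : (0 < k m)%N by near: m; exact: (k_oo _ (nbhs_infty_gt 0)).
have p33 : (33 <= p m)%N by near: m; exact: (p_oo _ (nbhs_infty_ge 33)).
have lnp1 : 1 <= ln ((p m)%:R : R).
  have pe : ((Num.truncn (expR 1 : R)).+1 <= p m)%N.
    by near: m; exact: (p_oo _ (nbhs_infty_ge _)).
  rewrite -[leLHS]expRK ler_ln ?posrE ?expR_gt0 ?ltr0n//; last exact: leq_trans p33.
  by rewrite (le_trans (ltW (truncnS_gt _)))// ler_nat.
apply/andP; split; last first.
  by apply: probability_le1; exact: measurable_comparison.
apply: (@comparison_whp_asymptotic _ _ _ _ _ _ _ _ (k_info m) c') => //.
  (* Distance below [c'] puts the ratio strictly between 0 and [2 c'], which gives both the
     positivity of [k_info m] and its upper bound. *)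
  have : `|c' - k_info m / (beta m ^+ 2 * (n m)%:R / ln ((p m)%:R : R))| < c'.
    by near: m; move/cvgrPdist_lt : ratio => /(_ _ c'0).
  set q := _ / ln _.
  have q0 : 0 < q.
    by rewrite divr_gt0 ?(lt_le_trans ltr01 lnp1)// mulr_gt0 ?exprn_gt0 ?ltr0n.
  rewrite ltr_norml ltrBlDl ltrBrDr -ltrBlDl => /andP[h1 h2].
  have h3 : 0 < k_info m / q by lra.
  have h4 : k_info m / q <= 2 * c' by lra.
  by rewrite -(pmulr_lgt0 _ (_ : 0 < q^-1)) ?invr_gt0// h3/= -ler_pdivrMr.
by rewrite lerDr.
Unshelve. all: by end_near.
Qed.
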